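(* The space Cremona group $\mathrm{Bir}(\mathbb{P}^3)$ contains an infinite number of pairwise non-conjugate subgroups isomorphic to the symmetric group $\mathfrak{S}_4$.
   Context: The space Cremona group is the group of birational selfmaps of $\mathbb{P}^3$ over $\mathbb{C}$. *)

(* Defs.v *)
From HB Require Import structures.
From mathcomp Require Import all_boot all_order all_algebra all_fingroup.
From mathcomp Require Import generic_quotient boolp.
From mathcomp Require Import mpoly.

Set Implicit Arguments.
Unset Strict Implicit.
Unset Printing Implicit Defensive.

Import GRing.Theory.
Local Open Scope ring_scope.
Local Open Scope quotient_scope.

(* The Cremona group Bir(P^n) over a field K.  A rational self-map of P^n is  *)
(*   [x_0 : ... : x_n] |--> [f_0(x) : ... : f_n(x)]                           *)
(* with f_0, ..., f_n homogeneous polynomials of the same degree, not all     *)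
(* zero; two such tuples define the same map iff they are proportional over   *)
(* the field of rational functions.                                           *)

Section CremonaGroup.
Variables (K : fieldType) (n : nat).

Notation pol := {mpoly K[n.+1]}.
Notation tup := (n.+1.-tuple pol).

Definition ratmap (f : tup) : Prop :=
  (exists d : nat, forall i, tnth f i \is d.-homog) /\
  (exists i, tnth f i != 0).

(* This relation is an equivalence on all tuples, and the zero tuple is       *)
(* related only to itself.                                                    *)
Definition proj_eq (f g : tup) : Prop :=
  exists a b : pol, [/\ a != 0, b != 0 &
    forall i, a * tnth f i = b * tnth g i].

Definition tup_id : tup := [tuple 'X_i | i < n.+1].

(* Substitution, representing x |--> f (g x).  The result can be the zero     *)
(* tuple, when the image of g is contained in the base locus of f.            *)
Definition tup_comp (f g : tup) : tup :=
  [tuple tnth f i \mPo g | i < n.+1].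

(* As tup_id is nonzero, proj_eq (tup_comp f g) tup_id includes that the      *)
(* composite is a well-defined rational map.                                  *)
Definition birational (f : tup) : Prop :=
  ratmap f /\ exists g : tup,
    [/\ ratmap g, proj_eq (tup_comp f g) tup_id
      & proj_eq (tup_comp g f) tup_id].

Record birat := Birat { birat_tup :> tup; _ : `[< birational birat_tup >] }.

HB.instance Definition _ := [isSub for birat_tup].
HB.instance Definition _ := [Choice of birat by <:].

Lemma biratP (f : birat) : birational f.
Proof. by case: f => f /= /asboolP. Qed.

Definition mk_birat f (bf : birational f) : birat := Birat (asboolT bf).

Lemma proj_eq_refl f : proj_eq f f.
Proof. by exists 1, 1; split; rewrite ?oner_neq0. Qed.

Lemma proj_eq_sym f g : proj_eq f g -> proj_eq g f.
Proof. by case=> a [b [a0 b0 e]]; exists b, a; split. Qed.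

Lemma proj_eq_trans g f h : proj_eq f g -> proj_eq g h -> proj_eq f h.
Proof.
case=> a [b [a0 b0 e]] [c [d [c0 d0 e']]]; exists (c * a), (b * d).
split; rewrite ?mulf_neq0 // => i.
by rewrite -mulrA e mulrCA e' mulrA.
Qed.

Definition birat_eq (f g : birat) : bool := `[< proj_eq f g >].

Lemma birat_eq_equiv : equiv_class_of birat_eq.
Proof.
split=> [f | f g | g f h].
- exact/asboolP/proj_eq_refl.
- by apply/idP/idP => /asboolP/proj_eq_sym/asboolP.
- by move=> /asboolP fg /asboolP gh; apply/asboolP/(proj_eq_trans fg gh).
Qed.

Canonical birat_equiv := EquivRelPack birat_eq_equiv.

Definition Bir := {eq_quot birat_equiv}.

HB.instance Definition _ := Choice.on Bir.

Lemma Bir_eqP (f g : birat) : \pi_Bir f = \pi_Bir g <-> proj_eq f g.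
Proof.
by split=> [/eqquotP/asboolP | fg]; last exact/eqquotP/asboolP.
Qed.

Lemma proj_eq_neq0 f g : proj_eq f g ->
  (exists i, tnth f i != 0) -> exists i, tnth g i != 0.
Proof.
case=> a [b [a0 b0 e]] [i fi]; exists i; apply: contraNneq fi => gi.
by have /eqP := e i; rewrite gi mulr0 mulf_eq0 (negbTE a0).
Qed.

Lemma tup_id_neq0 : exists i, tnth tup_id i != 0.
Proof.
exists ord0; rewrite tnth_mktuple; apply/eqP => /(congr1 (mcoeff U_(ord0))).
by rewrite mcoeffX mcoeff0 eqxx => /eqP; rewrite oner_eq0.
Qed.

Lemma ratmap_id : ratmap tup_id.
Proof.
split; last exact: tup_id_neq0.
by exists 1%N => i; rewrite tnth_mktuple dhomogX /= mdeg1.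
Qed.

Lemma comp_homogZ (d : nat) (p a : pol) (g h : tup) : p \is d.-homog ->
  (forall i, tnth h i = a * tnth g i) -> p \mPo h = a ^+ d * (p \mPo g).
Proof.
move=> /dhomogP hp hh; rewrite !comp_mpolyE mulr_sumr big_seq [RHS]big_seq.
apply: eq_bigr => m /hp; rewrite /= mdegE => <-.
rewrite -scalerAr; congr (_ *: _).
rewrite -prodrXr -big_split; apply: eq_bigr => i _.
by rewrite hh exprMn.
Qed.

Lemma comp_mpolyA (p : pol) (g h : tup) :
  p \mPo tup_comp g h = (p \mPo g) \mPo h.
Proof.
rewrite comp_mpolyE (comp_mpolyE p g) raddf_sum /=; apply: eq_bigr => m _.
rewrite comp_mpolyZ; congr (_ *: _).
by rewrite rmorph_prod; apply: eq_bigr => i _; rewrite rmorphXn tnth_mktuple.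
Qed.

Lemma tup_compA f g h :
  tup_comp f (tup_comp g h) = tup_comp (tup_comp f g) h.
Proof. by apply: eq_from_tnth => i; rewrite !tnth_mktuple comp_mpolyA. Qed.

Lemma tup_compf1 f : tup_comp f tup_id = f.
Proof. by apply: eq_from_tnth => i; rewrite !tnth_mktuple comp_mpoly_id. Qed.

Lemma tup_comp1f f : tup_comp tup_id f = f.
Proof.
by apply: eq_from_tnth => i; rewrite !tnth_mktuple comp_mpolyXU -tnth_nth.
Qed.

Lemma proj_eq_compr f g h : ratmap f -> proj_eq g h ->
  proj_eq (tup_comp f g) (tup_comp f h).
Proof.
case=> -[d hf] _ [a [b [a0 b0 e]]].
exists (a ^+ d), (b ^+ d); split; rewrite ?expf_neq0 // => i.
rewrite !tnth_mktuple.
rewrite -(@comp_homogZ _ _ a g [tuple a * tnth g i | i < n.+1]) //; last first.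
  by move=> j; rewrite tnth_mktuple.
by apply: comp_homogZ => // j; rewrite tnth_mktuple e.
Qed.

Lemma comp_homog (p : pol) (g : tup) d e : p \is d.-homog ->
  (forall i, tnth g i \is e.-homog) -> p \mPo g \is (e * d).-homog.
Proof.
move=> /dhomogP hp hg; rewrite comp_mpolyE big_seq; apply: rpred_sum => m /hp.
rewrite /= mdegE => <-; apply: dhomogZ.
rewrite big_distrr /=; elim: index_enum => [|i r IH].
  by rewrite !big_nil dhomog1.
by rewrite !big_cons dhomogM // dhomogMn.
Qed.

Lemma birational_comp_neq0 f g : ratmap f -> birational g ->
  exists i, tnth (tup_comp f g) i != 0.
Proof.
move=> rf [rg [g' [rg' gg' g'g]]].
have [i fi] : exists i, tnth (tup_comp f (tup_comp g g')) i != 0.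
  apply: proj_eq_neq0 rf.2; rewrite -{1}[f]tup_compf1.
  by apply: proj_eq_compr => //; apply: proj_eq_sym.
exists i; apply: contraNneq fi => fgi.
by rewrite tup_compA tnth_mktuple fgi comp_mpoly0.
Qed.

Lemma ratmap_comp f g : ratmap f -> birational g -> ratmap (tup_comp f g).
Proof.
move=> rf bg; split; last exact: birational_comp_neq0.
case: rf bg => -[d hf] _ [[[e hg] _] _]; exists (e * d)%N => i.
by rewrite tnth_mktuple comp_homog.
Qed.

Lemma proj_eq_cross f g : proj_eq f g ->
  forall i j, tnth f i * tnth g j = tnth f j * tnth g i.
Proof.
case=> a [b [a0 b0 e]] i j.
have /(mulfI a0) // : a * (tnth f i * tnth g j) = a * (tnth f j * tnth g i).
by rewrite !mulrA !e mulrAC.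
Qed.

Lemma cross_proj_eq f g :
  (exists i, tnth f i != 0) -> (exists i, tnth g i != 0) ->
  (forall i j, tnth f i * tnth g j = tnth f j * tnth g i) -> proj_eq f g.
Proof.
move=> [k fk] [l gl] e; exists (tnth g k), (tnth f k); split=> //.
  apply: contraNneq gl => gk; have /eqP := e k l.
  by rewrite gk mulr0 mulf_eq0 (negbTE fk).
by move=> i; rewrite mulrC e.
Qed.

Lemma proj_eq_compl f f' g : ratmap f -> ratmap f' -> birational g ->
  proj_eq f f' -> proj_eq (tup_comp f g) (tup_comp f' g).
Proof.
move=> rf rf' bg ff'; apply: cross_proj_eq; try exact: birational_comp_neq0.
by move=> i j; rewrite !tnth_mktuple -!rmorphM (proj_eq_cross ff').
Qed.

Lemma birational_id : birational tup_id.
Proof.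
split; first exact: ratmap_id.
exists tup_id; rewrite tup_comp1f; split; first exact: ratmap_id.
  exact: proj_eq_refl.
exact: proj_eq_refl.
Qed.

Lemma birational_inv f : birational f -> exists g : tup,
  [/\ birational g, proj_eq (tup_comp f g) tup_id
    & proj_eq (tup_comp g f) tup_id].
Proof. by case=> rf [g [rg fg gf]]; exists g; split=> //; split=> //; exists f. Qed.

Lemma comp_inverse f f' g g' :
    birational f -> birational f' -> birational g -> birational g' ->
    proj_eq (tup_comp f f') tup_id -> proj_eq (tup_comp g g') tup_id ->
  proj_eq (tup_comp (tup_comp f g) (tup_comp g' f')) tup_id.
Proof.
move=> bf bf' bg bg' ff' gg'; apply: proj_eq_trans ff'.
rewrite -tup_compA; apply: proj_eq_compr; first exact: bf.1.
rewrite tup_compA -{2}[f']tup_comp1f; apply: proj_eq_compl => //.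
  exact: ratmap_comp bg.1 bg'.
exact: ratmap_id.
Qed.

Lemma birational_comp f g :
  birational f -> birational g -> birational (tup_comp f g).
Proof.
move=> bf bg; split; first exact: ratmap_comp bf.1 bg.
have [f' [bf' ff' f'f]] := birational_inv bf.
have [g' [bg' gg' g'g]] := birational_inv bg.
exists (tup_comp g' f'); split; [exact: ratmap_comp bg'.1 bf' | |];
  exact: comp_inverse.
Qed.

Definition Bir_one : Bir := \pi_Bir (mk_birat birational_id).

Definition Bir_mul (x y : Bir) : Bir :=
  \pi_Bir (mk_birat (birational_comp (biratP (repr x)) (biratP (repr y)))).

Definition birat_inv (f : birat) : birat :=
  let g := cid (birational_inv (biratP f)) in
  mk_birat (let: And3 bg _ _ := projT2 g in bg).

Definition Bir_inv (x : Bir) : Bir := \pi_Bir (birat_inv (repr x)).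

Lemma birat_invP (f : birat) :
  proj_eq (tup_comp f (birat_inv f)) tup_id /\
  proj_eq (tup_comp (birat_inv f) f) tup_id.
Proof. by rewrite /birat_inv /=; case: cid => g [] /=. Qed.

Lemma proj_eq_repr (f : birat) : proj_eq (repr (\pi_Bir f)) f.
Proof. by apply/Bir_eqP; rewrite reprK. Qed.

Lemma proj_eq_comp (f f' g g' : birat) : proj_eq f f' -> proj_eq g g' ->
  proj_eq (tup_comp f g) (tup_comp f' g').
Proof.
move=> ff' gg'; apply: (@proj_eq_trans (tup_comp f g')).
  exact: proj_eq_compr (biratP f).1 gg'.
exact: proj_eq_compl (biratP f).1 (biratP f').1 (biratP g') ff'.
Qed.

(* The group law is the composition of maps, (x * y)(p) = x(y(p)).            *)
Lemma Bir_mulE (f g : birat) : Bir_mul (\pi_Bir f) (\pi_Bir g) =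
  \pi_Bir (mk_birat (birational_comp (biratP f) (biratP g))).
Proof. by apply/Bir_eqP => /=; apply: proj_eq_comp; apply: proj_eq_repr. Qed.

Lemma Bir_mulA : associative Bir_mul.
Proof.
elim/quotW=> f; elim/quotW=> g; elim/quotW=> h.
rewrite (Bir_mulE g h) (Bir_mulE f g) !Bir_mulE.
by apply/Bir_eqP; rewrite /= tup_compA; apply: proj_eq_refl.
Qed.

Lemma Bir_mul1g : left_id Bir_one Bir_mul.
Proof.
elim/quotW=> f; rewrite Bir_mulE; apply/Bir_eqP.
by rewrite /= tup_comp1f; apply: proj_eq_refl.
Qed.

Lemma Bir_mulg1 : right_id Bir_one Bir_mul.
Proof.
elim/quotW=> f; rewrite Bir_mulE; apply/Bir_eqP.
by rewrite /= tup_compf1; apply: proj_eq_refl.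
Qed.

Lemma Bir_mulVg : left_inverse Bir_one Bir_inv Bir_mul.
Proof.
move=> x; rewrite -[X in Bir_mul _ X]reprK Bir_mulE /=.
exact/Bir_eqP/(birat_invP _).2.
Qed.

Lemma Bir_mulgV : right_inverse Bir_one Bir_inv Bir_mul.
Proof.
move=> x; rewrite -[X in Bir_mul X _]reprK Bir_mulE.
exact/Bir_eqP/(birat_invP _).1.
Qed.

HB.instance Definition _ :=
  isGroup.Build Bir Bir_mulA Bir_mul1g Bir_mulg1 Bir_mulVg Bir_mulgV.

End CremonaGroup.

Section Subgroups.
Variable G : groupType.
Local Open Scope group_scope.

Definition subgroup_isog (gT : groupType) (H : groupClosed G) : Prop :=
  exists f : {multiplicative gT -> G},
    injective f /\ forall x, x \in H <-> exists s, f s = x.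

Definition conj_subgroups (H L : groupClosed G) : Prop :=
  exists g : G, forall x, x \in L <-> x ^ g \in H.

End Subgroups.

(* Main.v *)
Require Import Defs.
From HB Require Import structures.
From mathcomp Require Import all_boot all_order all_algebra all_fingroup.
From mathcomp Require Import generic_quotient fraction boolp mpoly.
From mathcomp Require Import ring zify.
From mathcomp Require Import reals complex.

(** A birational map of P^3 acts on the function field F = C(x, y, U), and
    conjugate groups of birational maps have isomorphic actions on F.  The groups
    constructed here are told apart by an invariant of the involutions in them.

    The groups.  Put c_1 = x, c_2 = y, c_3 = - x - y and t_j = c_j ^ n.  On the
    projective line over C(x, y) with coordinate U there are four points oo, t_1,
    t_2, t_3.  Every double transposition of four points of a line is induced by
    exactly one projective involution, here
      U - t_j |-> (t_i - t_j) (t_l - t_j) / (U - t_j),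
    and these involutions form a Klein four-group.  The permutations of the c_j,
    with U fixed, normalize it, and the two groups generate a copy of S_4
    (klein_mul, klein_stab, rep_mul).

    The invariant.  For an involution s of F, call an element e of the fixed field
    even if v(e) is even for all s-invariant valuations v : F^* -> Z.  The norms
    f * s f are even; the invariant is the number of classes of even elements
    modulo norms.  It is a field-theoretic version of the order of H^1(<s>, Pic V)
    for a smooth projective model V of F, which is large when s fixes a surface
    that is ruled over a curve of large genus.  For the involution with j = 1, the
    element T = U - t_1 satisfies T * s T = h, where h = (t_2 - t_1) (t_3 - t_1),
    and the fixed surface is T ^ 2 = h.

    The invariant is finite (finitely_many_classes).  The involution s acts on the
    factorial ring C[x, y, T, 1/T, 1/h] and permutes its primes.  An even
    invariant contains a prime together with its conjugate, so that it is a norm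
    times a unit, and the units have finitely many classes modulo norms.

    The invariant is unbounded (many_classes_disc).  For n = 2 ^ (k + 1), the form
    h in x and y is divisible by x ^ N + y ^ N for N = 2, 4, .., 2 ^ k.  Such a
    factor has even degree and is coprime to its cofactor, hence it is even
    (even_form).  If the quotient of two products of these factors is a norm, it is
    the norm of a unit (sunit_norm), so that it is a square or h times a square in
    C(x, y), and the two products have the same factors (form_prod_not_square).

    In S_4 the double transpositions are the involutions that are squares, and
    they are conjugate to each other.  Hence a conjugacy between two of the groups
    can be chosen to carry the involution with j = 1 to the one with j = 1
    (conj_many_classes), and infinitely many values of n give groups that are
    pairwise non-conjugate. *)

Set Implicit Arguments.
Unset Strict Implicit.
Unset Printing Implicit Defensive.

Import Order.TTheory GRing.Theory Num.Theory.
Local Open Scope ring_scope.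
Local Open Scope quotient_scope.

(** * Factorial rings *)

Definition rdvd (A : idomainType) (a b : A) := exists c, b = a * c.

Definition prime_elt (A : idomainType) (p : A) :=
  [/\ p != 0, p \isn't a GRing.unit
    & forall a b, rdvd p (a * b) -> rdvd p a \/ rdvd p b].

Definition factorial_ring (A : idomainType) := forall a : A, a != 0 ->
  exists c s, [/\ c \is a GRing.unit, {in s, forall p, prime_elt p}
                & a = c * \prod_(p <- s) p].

Section Divisibility.
Variable A : idomainType.
Implicit Types a b c p q : A.

Lemma rdvd_refl a : rdvd a a.
Proof. by exists 1; rewrite mulr1. Qed.

Lemma rdvd0 a : rdvd a 0.
Proof. by exists 0; rewrite mulr0. Qed.

Lemma rdvd_trans b a c : rdvd a b -> rdvd b c -> rdvd a c.
Proof. by case=> x -> [y ->]; exists (x * y); rewrite mulrA. Qed.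

Lemma rdvd_mulr a b c : rdvd a b -> rdvd a (b * c).
Proof. by case=> x ->; exists (x * c); rewrite mulrA. Qed.

Lemma rdvd_mull a b c : rdvd a b -> rdvd a (c * b).
Proof. by rewrite mulrC; apply: rdvd_mulr. Qed.

Lemma rdvdD a b c : rdvd a b -> rdvd a c -> rdvd a (b + c).
Proof. by case=> x -> [y ->]; exists (x + y); rewrite mulrDr. Qed.

Lemma rdvdB a b c : rdvd a b -> rdvd a c -> rdvd a (b - c).
Proof. by case=> x -> [y ->]; exists (x - y); rewrite mulrBr. Qed.

Lemma prime_ndvd_unit p c : prime_elt p -> c \is a GRing.unit -> ~ rdvd p c.
Proof.
case=> _ /negP pu _ cu [d def_c]; apply: pu.
by move: cu; rewrite def_c unitrM => /andP[].
Qed.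

Lemma prime_dvd_exp p a n : prime_elt p -> rdvd p (a ^+ n) -> rdvd p a.
Proof.
move=> pp; elim: n => [|n IH]; rewrite ?expr0.
  by move/(prime_ndvd_unit pp (unitr1 _)).
by rewrite exprS => /(let: And3 _ _ h := pp in h)[].
Qed.

Lemma prime_dvd_prod p s : prime_elt p -> rdvd p (\prod_(q <- s) q) ->
  exists2 q, q \in s & rdvd p q.
Proof.
move=> pp; elim: s => [|q s IH]; rewrite ?big_nil ?big_cons.
  by move/(prime_ndvd_unit pp (unitr1 _)).
case/(let: And3 _ _ h := pp in h) => [pq|/IH[r rs pr]].
  by exists q; rewrite ?inE ?eqxx.
by exists r; rewrite // inE rs orbT.
Qed.

Lemma prime_assoc p q : prime_elt p -> prime_elt q -> rdvd p q ->
  exists2 c, c \is a GRing.unit & q = p * c.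
Proof.
move=> [p0 pu pp] [q0 qu qq] [c def_q]; exists c => //.
have [|[d def_p]|[d def_c]] := qq p c; first by rewrite -def_q; exact: rdvd_refl.
  have /(mulfI q0) : q * (d * c) = q * 1 by rewrite mulrA -def_p mulr1.
  by rewrite mulrC => dc; apply/unitrPr; exists d.
case/negP: pu; apply/unitrPr; exists d.
have /(mulfI q0) // : q * (p * d) = q * 1.
by rewrite mulr1 mulrCA -def_c.
Qed.

End Divisibility.

Section GaussLemma.
Variable A : idomainType.
Hypothesis ufdA : factorial_ring A.
Implicit Types f g k m : {poly A}.

Lemma rdvd_polyC (p a : A) : rdvd p%:P a%:P <-> rdvd p a.
Proof.
split=> [[f /(congr1 (fun g => g`_0))]|[c ->]].
  by rewrite mulrC coefMC coefC /= mulrC => ->; exists f`_0.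
by exists c%:P; rewrite polyCM.
Qed.

(** If p divides f * g, it divides the product of the leading coefficients, hence
    one of them; removing that leading term lowers the degree. *)
Lemma prime_polyC (p : A) : prime_elt p -> prime_elt p%:P.
Proof.
move=> pp; have [p0 pu pM] := pp.
split; first by rewrite polyC_eq0.
  by rewrite poly_unitE size_polyC p0 coefC.
have coefp f i : rdvd p%:P f -> rdvd p f`_i.
  by case=> g ->; rewrite coefCM; exists g`_i.
pose trim f := f - lead_coef f *: 'X^((size f).-1).
have trimE f : f = lead_coef f *: 'X^((size f).-1) + trim f.
  by rewrite addrC subrK.
have size_trim f : f != 0 -> (size (trim f) < size f)%N.
  move=> f0; rewrite (polySpred f0) ltnS; apply/leq_sizeP => j.
  rewrite leq_eqVlt coefB coefZ coefXn => /predU1P[<-|lt_j].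
    by rewrite eqxx mulr1 subrr.
  by rewrite gtn_eqF // mulr0 subr0 nth_default // (polySpred f0).
have dvdl f : rdvd p (lead_coef f) -> rdvd p%:P (lead_coef f *: 'X^((size f).-1)).
  by case=> c ->; exists (c *: 'X^((size f).-1)); rewrite -scalerA mul_polyC.
move=> f g; have [N] := ubnP (size f + size g)%N.
elim: N f g => // N IH f g /ltnSE-le_fg dvd_fg.
have [->|f0] := eqVneq f 0; first by left; apply: rdvd0.
have [->|g0] := eqVneq g 0; first by right; apply: rdvd0.
have := coefp _ (size (f * g)).-1 dvd_fg; rewrite -lead_coefE lead_coefM.
case/pM => /dvdl dl.
- case: (IH (trim f) g) => [| |tf|]; last by right.
  + by apply: leq_trans le_fg; rewrite ltn_add2r size_trim.
  + by rewrite mulrBl; apply: rdvdB => //; apply: rdvd_mulr.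
  + by left; rewrite (trimE f); apply: rdvdD.
- case: (IH f (trim g)) => [| | |tg]; last 1 first.
  + by right; rewrite (trimE g); apply: rdvdD.
  + by apply: leq_trans le_fg; rewrite ltn_add2l size_trim.
  + by rewrite mulrBr; apply: rdvdB => //; apply: rdvd_mull.
  + by left.
Qed.

Lemma polyC_unit (c : A) : c \is a GRing.unit -> c%:P \is a GRing.unit.
Proof. by move=> cu; apply: rmorph_unit. Qed.

Definition primitive f := forall p : A, prime_elt p -> ~ rdvd p%:P f.

(** The prime factors of c divide f * m, where c * g = f * m, but not f: they can
    be cancelled from m one after the other. *)
Lemma gauss_cancel c f g : primitive f -> c != 0 -> rdvd f (c%:P * g) ->
  rdvd f g.
Proof.
move=> prf /ufdA[d [s [du ps ->]]] {c}; elim: s ps g => [|p s IH] ps g.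
  rewrite big_nil mulr1 => -[m e]; exists (d^-1%:P * m).
  by rewrite mulrCA -e mulrA -polyCM mulVr // mul1r.
rewrite big_cons mulrCA polyCM -mulrA => -[m e].
have pp : prime_elt p by apply: ps; rewrite inE eqxx.
have [_ _ pM] := prime_polyC pp.
case: (pM f m) => [|/(prf p pp)//|[m' def_m]].
  by rewrite -e; apply/rdvd_mulr/rdvd_refl.
apply: IH => [q qs|]; first by apply: ps; rewrite inE qs orbT.
exists m'; have [p0 _ _] := prime_polyC pp; apply: (mulfI p0).
by rewrite e def_m mulrCA.
Qed.

(** A factorization over the field of fractions, with its denominators cleared,
    comes from a factorization over the ring with factors of the same degrees. *)
Lemma gauss_split c f g k : c != 0 -> c%:P * f = g * k ->
  exists g' k', [/\ f = g' * k', size g' = size g & size k' = size k].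
Proof.
move=> /ufdA[d [s [du ps ->]]] {c}; elim: s ps g k => [|p s IH] ps g k.
  rewrite big_nil mulr1 => e; exists (d^-1 *: g), k; split=> //.
    by rewrite -scalerAl -e -mul_polyC mulrA -polyCM mulVr // mul1r.
  by rewrite size_scale // invr_eq0; apply: contraTneq du => ->; rewrite unitr0.
have pp : prime_elt p by apply: ps; rewrite inE eqxx.
have [p0 _ _] := pp; have [P0 _ pM] := prime_polyC pp.
rewrite big_cons mulrCA polyCM -mulrA => e.
have {}IH := IH (fun q qs => ps q (mem_behead (s := p :: s) qs)).
case: (pM g k) => [|[g1 def_g]|[k1 def_k]].
- by rewrite -e; apply/rdvd_mulr/rdvd_refl.
- have [|g' [k' [-> sg sk]]] := IH g1 k.
    by apply: (mulfI P0); rewrite e def_g mulrA.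
  by exists g', k'; split=> //; rewrite sg def_g mul_polyC size_scale.
- have [|g' [k' [-> sg sk]]] := IH g k1.
    by apply: (mulfI P0); rewrite e def_k mulrCA.
  by exists g', k'; split=> //; rewrite sk def_k mul_polyC size_scale.
Qed.

(** The extraction of constant prime factors stops, because each of them removes a
    prime factor from the leading coefficient. *)
Lemma content f : f != 0 ->
  exists c g, [/\ c != 0, f = c%:P * g & primitive g].
Proof.
move=> f0; have /ufdA[d [s [du ps]]]: lead_coef f != 0 by rewrite lead_coef_eq0.
have [N] := ubnP (size s); elim: N f f0 s ps d du => // N IH f f0 s ps d du.
move=> /ltnSE-le_s def_l.
have [prf|] := pselect (primitive f).
  by exists 1, f; rewrite oner_eq0 mul1r.
move/existsNP=> [p /not_implyP[pp /contrapT[g def_f]]].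
have [p0 _ _] := pp.
have g0 : g != 0 by apply: contraNneq f0 => g0; rewrite def_f g0 mulr0.
have pl : rdvd p (d * \prod_(q <- s) q).
  rewrite -def_l def_f lead_coefM lead_coefC; exact/rdvd_mulr/rdvd_refl.
have [_ _ /(_ _ _ pl)[/(prime_ndvd_unit pp du)//|]] := pp.
case/(prime_dvd_prod pp) => q qs /(prime_assoc pp (ps _ qs))[u uu def_q].
have [||||c [g' [c0 def_g prg]]] := IH g g0 (rem q s) _ (d * u).
- by move=> r /mem_rem; apply: ps.
- by rewrite unitrM du.
- by rewrite size_rem //; move: qs le_s; case: (s).
- apply: (mulfI p0); rewrite -[in LHS](lead_coefC p) -lead_coefM -def_f def_l.
  by rewrite (perm_big _ (perm_to_rem qs)) big_cons def_q; rewrite [RHS]mulrCA !mulrA (mulrAC d).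
exists (p * c), g'; split=> //; first by rewrite mulf_neq0.
by rewrite def_f def_g polyCM mulrA.
Qed.

(** A primitive polynomial that has no factorization into two polynomials of
    smaller degree is prime: pseudo-division decides divisibility over the field
    of fractions, and Gauss' lemma clears the denominators. *)
Lemma primitive_prime f : primitive f -> (1 < size f)%N ->
    (forall g k, f = g * k -> (size g <= 1)%N \/ (size k <= 1)%N) ->
  prime_elt f.
Proof.
move=> prf sf irf; have f0 : f != 0 by rewrite -size_poly_gt0 ltnW.
split=> //; first by rewrite poly_unitE gtn_eqF.
have dvdE g : f %| g -> rdvd f g.
  case/Pdiv.Idomain.dvdpP => -[c q] /= c0; rewrite -mul_polyC => e.
  by apply: (@gauss_cancel c) => //; exists q; rewrite e mulrC.
move=> g k [m e].
have /Pdiv.Idomain.dvdpP[[c q] /= c0] := Pdiv.Idomain.dvdp_gcdl f g.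
rewrite -mul_polyC => def_f.
have [q' [d' [def_f' sq sd]]] := gauss_split c0 def_f.
case: (irf _ _ def_f') => [s1|s1].
  left; apply: dvdE; apply: Pdiv.Idomain.dvdp_trans (Pdiv.Idomain.dvdp_gcdr f g).
  have := Pdiv.Idomain.dvdp_size_eqp (Pdiv.Idomain.dvdp_gcdl f g).
  suff -> : size (gcdp f g) == size f by case/esym/andP.
  have q0 : q != 0.
    apply: contraTneq f0 => q0; have := def_f; rewrite q0 mul0r => /eqP.
    by rewrite mulf_eq0 polyC_eq0 (negbTE c0) /= => ->.
  move: s1; rewrite sq leq_eqVlt ltnS leqn0 size_poly_eq0 (negbTE q0) orbF.
  move/size_poly1P=> [a a0 def_q].
  have := congr1 (size \o val) def_f.
  by rewrite /= def_q !mul_polyC !size_scale // => ->.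
right; apply: dvdE; rewrite -(@Pdiv.Idomain.Gauss_dvdpr _ _ g) //.
  by rewrite e Pdiv.Idomain.dvdp_mulr.
rewrite /coprimep eqn_leq -sd s1 sd size_poly_gt0.
by rewrite Pdiv.Idomain.gcdp_eq0 negb_and f0.
Qed.

Theorem factorial_poly : factorial_ring {poly A}.
Proof.
move=> f; have [N] := ubnP (size f); elim: N f => // N IH f /ltnSE-le_f f0.
have [c [g [c0 def_f prg]]] := content f0.
have [d [s [du ps def_c]]] := ufdA c0.
have {}def_c : c%:P = d%:P * \prod_(p <- map polyC s) p.
  by rewrite big_map -rmorph_prod -polyCM def_c.
have {}ps : {in map polyC s, forall p, prime_elt p}.
  by move=> _ /mapP[p /ps/prime_polyC pp ->].
have {}du := polyC_unit du.
have g0 : g != 0 by apply: contraNneq f0 => g0; rewrite def_f g0 mulr0.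
have sg : size g = size f by rewrite def_f mul_polyC size_scale.
suff [e [t [eu pt def_g]]] : exists e t, [/\ e \is a GRing.unit,
    {in t, forall p, prime_elt p} & g = e * \prod_(p <- t) p].
  exists (d%:P * e), (map polyC s ++ t); split; first by rewrite unitrM du.
    by move=> p; rewrite mem_cat => /orP[/ps|/pt].
  by rewrite big_cat def_f def_c def_g mulrACA.
have [s1|s1] := leqP (size g) 1.
  have [|a a0 ->] := size_poly1P g _.
    by rewrite eqn_leq s1 size_poly_gt0.
  have [e [t [eu pt ->]]] := ufdA a0.
  exists e%:P, (map polyC t); split; first exact: polyC_unit.
    by move=> _ /mapP[p /pt/prime_polyC pp ->].
  by rewrite big_map -rmorph_prod -polyCM.
have [|] := pselect (forall h k, g = h * k -> (size h <= 1)%N \/ (size k <= 1)%N).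
  move/(primitive_prime prg s1) => pg; exists 1, [:: g]; split.
  - exact: unitr1.
  - by move=> p; rewrite inE => /eqP->.
  - by rewrite big_seq1 mul1r.
move/existsNP=> [h /existsNP[k /not_implyP[def_g /not_orP[]]]].
move=> /negP; rewrite -ltnNge => sh /negP; rewrite -ltnNge => sk.
have h0 : h != 0 by rewrite -size_poly_gt0 ltnW.
have k0 : k != 0 by rewrite -size_poly_gt0 ltnW.
have := sg; rewrite def_g size_mul // => shk.
have lt_h : (size h < N)%N.
  by apply: leq_trans le_f; rewrite -shk; case: (size k) sk => [|[|j]] //= _; rewrite !addnS ltnS leq_addr.
have lt_k : (size k < N)%N.
  by apply: leq_trans le_f; rewrite -shk; case: (size h) sh => [|[|j]] //= _; rewrite !addSn ltnS leq_addl.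
have [e1 [t1 [eu1 pt1 ->]]] := IH h lt_h h0.
have [e2 [t2 [eu2 pt2 ->]]] := IH k lt_k k0.
exists (e1 * e2), (t1 ++ t2); split; first by rewrite unitrM eu1.
  by move=> p; rewrite mem_cat => /orP[/pt1|/pt2].
by rewrite big_cat mulrACA.
Qed.

End GaussLemma.

Lemma factorial_field (K : fieldType) : factorial_ring K.
Proof.
by move=> a a0; exists a, [::]; rewrite unitfE big_nil mulr1; split.
Qed.

(** * Valuations and even invariants *)

Definition valuation (F : fieldType) (v : F -> int) :=
  {in [pred x | x != 0] &, {morph v : x y / x * y >-> x + y}} /\
  (forall x y, x != 0 -> y != 0 -> x + y != 0 ->
     Num.min (v x) (v y) <= v (x + y)).

Definition even_elt (F : fieldType) (s : F -> F) (e : F) :=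
  forall v : F -> int, valuation v -> (forall x, v (s x) = v x) ->
  exists k, v e = k + k.

(** Being equal up to a norm is an equivalence relation on the even invariants,
    with at least M classes. *)
Definition many_classes (F : fieldType) (s : F -> F) (M : nat) :=
  exists e : 'I_M -> F,
    (forall i, [/\ e i != 0, s (e i) = e i & even_elt s (e i)]) /\
    (forall i j f, e i = f * s f * e j -> i = j).

Section Valuation.
Variables (F : fieldType) (v : F -> int).
Hypothesis valv : valuation v.

Lemma valM x y : x != 0 -> y != 0 -> v (x * y) = v x + v y.
Proof. by case: valv => vM _; apply: vM. Qed.

Lemma val1 : v 1 = 0.
Proof.
have := valM (oner_neq0 F) (oner_neq0 F); rewrite mulr1 => h.
by apply: (addrI (v 1)); rewrite addr0 -h.
Qed.

Lemma valV x : x != 0 -> v x^-1 = - v x.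
Proof.
move=> x0; apply/eqP; rewrite -addr_eq0 addrC -valM ?invr_eq0 //.
by rewrite mulfV // val1.
Qed.

Lemma valX x n : x != 0 -> v (x ^+ n) = v x *+ n.
Proof.
move=> x0; elim: n => [|n IH]; first by rewrite expr0 val1.
by rewrite exprS valM ?expf_neq0 // IH mulrS.
Qed.

Lemma val_prod (I : finType) (f : I -> F) : (forall i, f i != 0) ->
  v (\prod_i f i) = \sum_i v (f i).
Proof.
move=> f0; suff [] : \prod_i f i != 0 /\ v (\prod_i f i) = \sum_i v (f i) by [].
elim/big_rec2: _ => [|i y z _ [y0 <-]]; first by rewrite oner_eq0 val1.
by rewrite mulf_neq0 // valM.
Qed.

Lemma valN x : x != 0 -> v (- x) = v x.
Proof.
move=> x0; have n10 : -1 != 0 :> F by rewrite oppr_eq0 oner_eq0.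
have h : v (-1) + v (-1) = 0 by rewrite -valM // mulrNN mulr1 val1.
have {h} vN1 : v (-1) = 0 by move: h; case: (v (-1)) => n h; lia.
by rewrite -mulN1r valM // vN1 add0r.
Qed.

Lemma valD x y : x != 0 -> y != 0 -> x + y != 0 ->
  Num.min (v x) (v y) <= v (x + y).
Proof. by case: valv => _; apply. Qed.

Lemma valD_lt x y : x != 0 -> y != 0 -> v x < v y ->
  x + y != 0 /\ v (x + y) = v x.
Proof.
move=> x0 y0 lt_xy; have xy0 : x + y != 0.
  by apply: contraTneq lt_xy => /eqP; rewrite addr_eq0 => /eqP->; rewrite valN // ltxx.
split=> //; apply/eqP; rewrite eq_le; apply/andP; split; last first.
  by have := valD x0 y0 xy0; rewrite min_l // ltW.
have := @valD (x + y) (- y) xy0; rewrite oppr_eq0 addrK => /(_ y0 x0).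
by rewrite valN // ge_min => /orP[|/(lt_le_trans lt_xy)] //; rewrite ltxx.
Qed.

End Valuation.

(** * Multiplicity of a prime element *)

Section Multiplicity.
Variables (A : idomainType) (F : fieldType) (io : {rmorphism A -> F}).
Hypotheses (ufdA : factorial_ring A) (io_inj : injective io).
Hypothesis io_frac : forall z, exists a b, b != 0 /\ z = io a / io b.
Variable p : A.
Hypothesis pp : prime_elt p.

Let io0 a : (io a == 0) = (a == 0).
Proof. by rewrite -(rmorph0 io) (inj_eq io_inj). Qed.

Let p0 : p != 0. Proof. by case: pp. Qed.
Let P0 : io p != 0. Proof. by rewrite io0. Qed.

Lemma ndvd_neq0 a : ~ rdvd p a -> a != 0.
Proof. by move=> pa; apply/eqP => a0; case: pa; rewrite a0; apply: rdvd0. Qed.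

Lemma ndvdM a b : ~ rdvd p a -> ~ rdvd p b -> ~ rdvd p (a * b).
Proof. by move=> pa pb; case: pp => _ _ h /h[]. Qed.

Lemma prime_power_factor a : a != 0 ->
  exists n b, a = p ^+ n * b /\ ~ rdvd p b.
Proof.
move=> /ufdA[c [s [cu ps ->]]]; elim: s ps => [|q s IH] ps.
  by exists 0, c; rewrite big_nil mulr1 expr0 mul1r; split=> //; apply: prime_ndvd_unit.
have [|n [b [e pb]]] := IH; first by move=> r rs; apply: ps; rewrite inE rs orbT.
have pq : prime_elt q by apply: ps; rewrite inE eqxx.
rewrite big_cons mulrCA e; have [dpq|dpq] := pselect (rdvd p q).
  have [d du ->] := prime_assoc pp pq dpq.
  exists n.+1, (d * b); rewrite exprS mulrACA; split=> //.
  by apply: ndvdM => //; apply: prime_ndvd_unit.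
by exists n, (q * b); rewrite mulrCA; split=> //; apply: ndvdM.
Qed.

Definition has_order (z : F) (k : int) :=
  exists a b, [/\ ~ rdvd p a, ~ rdvd p b & z = io p ^ k * (io a / io b)].

Lemma has_order_neq0 z k : has_order z k -> z != 0.
Proof.
case=> a [b [/ndvd_neq0 pa /ndvd_neq0 pb ->]].
by rewrite !mulf_neq0 ?expfz_neq0 ?invr_eq0 ?io0.
Qed.

Lemma has_order_uniq z k l : has_order z k -> has_order z l -> k = l.
Proof.
wlog lt_kl : k l / k < l => [hw hk hl|].
  by case: (ltgtP k l) => // lt_kl; [exact: hw lt_kl hk hl | symmetry; exact: hw lt_kl hl hk].
case=> a [b [pa pb ->]] [c [d [pc pd]]] e; exfalso.
have [n def_l] : exists n : nat, l = k + n.+1%:Z.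
  by exists (absz (l - k - 1)%R); lia.
move: e; rewrite def_l expfzDr // -mulrA.
move/(mulfI (expfz_neq0 k P0)) => /(congr1 ( *%R^~ (io b * io d))).
have b0 : io b != 0 by rewrite io0; apply: ndvd_neq0.
have d0 : io d != 0 by rewrite io0; apply: ndvd_neq0.
have -> : io a / io b * (io b * io d) = io (a * d) by rewrite rmorphM /=; field.
have -> : io p ^ n.+1 * (io c / io d) * (io b * io d) = io (p * (p ^+ n * (c * b))).
  by rewrite !rmorphM rmorphXn /= -exprnP exprS; field.
move/io_inj => e; case: (ndvdM pa pd); rewrite e.
exact/rdvd_mulr/rdvd_refl.
Qed.

Lemma has_order_ex z : z != 0 -> exists k, has_order z k.
Proof.
have [a [b [b0 ->]]] := io_frac z => z0.
have a0 : a != 0 by apply: contraNneq z0 => ->; rewrite rmorph0 mul0r.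
have [n [c [-> pc]]] := prime_power_factor a0.
have [m [d [-> pd]]] := prime_power_factor b0.
exists (n%:Z - m%:Z), c, d; split=> //.
rewrite expfzDr // -exprnN -exprnP !rmorphM !rmorphXn /=.
have d0 : io d != 0 by rewrite io0; apply: ndvd_neq0.
by field; rewrite d0 expf_neq0.
Qed.

Definition order (z : F) : int :=
  if pselect (exists k, has_order z k) is left h then projT1 (cid h) else 0.

Lemma orderP z : z != 0 -> has_order z (order z).
Proof.
move=> /has_order_ex h; rewrite /order; case: pselect => // h'.
exact: (projT2 (cid h')).
Qed.

Lemma orderE z k : has_order z k -> order z = k.
Proof. by move=> zk; apply: has_order_uniq (orderP (has_order_neq0 zk)) zk. Qed.

Lemma order_valuation : valuation order.
Proof.
split=> [x y|x y].
  rewrite !inE => /orderP[a [b [pa pb ex]]] /orderP[c [d [pc pd ey]]].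
  apply: orderE; exists (a * c), (b * d); split; try exact: ndvdM.
  by rewrite {1}ex {1}ey expfzDr // !rmorphM invfM /= mulrACA; congr (_ * _); rewrite mulrACA.
wlog le_xy : x y / order x <= order y => [hw x0 y0 xy0|].
  case: (leP (order x) (order y)) => le_xy.
    by have := hw x y le_xy x0 y0 xy0; rewrite min_l.
  by have := hw y x (ltW le_xy) y0 x0; rewrite addrC => /(_ xy0); rewrite min_l // ltW.
move=> /orderP[a [b [pa pb ex]]] /orderP[c [d [pc pd ey]]] xy0; rewrite min_l //.
have [n def_y] : exists n : nat, order y = order x + n%:Z.
  by exists (absz (order y - order x)%R); lia.
have b0 : io b != 0 by rewrite io0; apply: ndvd_neq0.
have d0 : io d != 0 by rewrite io0; apply: ndvd_neq0.
have e : x + y = io p ^ order x * (io (a * d + p ^+ n * c * b) / io (b * d)).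
  rewrite [in LHS]ex [in LHS]ey def_y expfzDr // -exprnP.
  by rewrite rmorphD !rmorphM rmorphXn /=; field; rewrite b0 d0.
have num0 : a * d + p ^+ n * c * b != 0.
  by apply: contraNneq xy0 => num0; rewrite e num0 rmorph0 mul0r mulr0.
have [m [g [def_g pg]]] := prime_power_factor num0.
suff -> : order (x + y) = order x + m%:Z by rewrite lerDl.
apply: orderE; exists g, (b * d); split=> //; first exact: ndvdM.
by rewrite e def_g expfzDr // -exprnP -mulrA rmorphM rmorphXn /= !mulrA.
Qed.

End Multiplicity.

(** * Involutions that send T to h / T *)

Lemma one_not_double (i : int) : 1 <> i + i.
Proof. lia. Qed.

Section ConicInvolution.
Variables (A : idomainType) (F : fieldType) (io : {rmorphism {poly A} -> F}).
Hypotheses (ufdA : factorial_ring A) (io_inj : injective io).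
Hypothesis io_frac : forall z, exists a b, b != 0 /\ z = io a / io b.
Variables (s : {rmorphism F -> F}) (h : A).
Notation T := (io 'X).
Notation k a := (io (polyC a)).
Hypotheses (sK : involutive s) (sA : forall a : A, s (k a) = k a).
Hypotheses (h0 : h != 0) (sT : T * s T = k h).

Let ufdX := factorial_poly ufdA.

Let io0 a : (io a == 0) = (a == 0).
Proof. by rewrite -(rmorph0 io) (inj_eq io_inj). Qed.

Let k0 a : (k a == 0) = (a == 0). Proof. by rewrite io0 polyC_eq0. Qed.

Let s0 z : (s z == 0) = (z == 0).
Proof. exact: fmorph_eq0. Qed.

Let T0 : T != 0. Proof. by rewrite io0 polyX_eq0. Qed.

Let sTE : s T = k h / T. Proof. by rewrite -sT mulrAC mulfV // mul1r. Qed.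

(** The primes that survive in the localization of A[T] at T and h. *)
Definition good p := [/\ prime_elt p, ~ rdvd p 'X & ~ rdvd p h%:P].

(** The units of the localization of A[T] at T and h. *)
Definition sunit (u : F) := exists (i : int) a b n,
  [/\ rdvd a (h ^+ n), rdvd b (h ^+ n) & u = T ^ i * (k a / k b)].

Let dvd_hX a n : rdvd a (h ^+ n) -> a != 0.
Proof.
by case=> c e; apply: contraTneq h0 => a0; move/eqP: e; rewrite a0 mul0r expf_eq0 => /andP[_ ->].
Qed.

Let dvd_hXM a b n m : rdvd a (h ^+ n) -> rdvd b (h ^+ m) ->
  rdvd (a * b) (h ^+ (n + m)).
Proof. by case=> x e [y e']; exists (x * y); rewrite exprD e e' mulrACA. Qed.

Lemma sunit_neq0 u : sunit u -> u != 0.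
Proof.
case=> i [a [b [n [da db ->]]]].
by rewrite mulf_neq0 ?expfz_neq0 ?mulf_neq0 ?invr_eq0 ?k0 ?(dvd_hX da) ?(dvd_hX db).
Qed.

Lemma sunit_dvd_h a n : rdvd a (h ^+ n) -> sunit (k a).
Proof.
move=> da; exists 0, a, 1, n; split=> //; first by exists (h ^+ n); rewrite mul1r.
by rewrite expr0z mul1r polyC1 rmorph1 invr1 mulr1.
Qed.

Lemma sunit1 : sunit 1.
Proof. by rewrite -(rmorph1 io) -polyC1; apply: (@sunit_dvd_h 1 0); exact: rdvd_refl. Qed.

Lemma sunit_constant (c : A) : c \is a GRing.unit -> sunit (k c).
Proof. by move=> cu; apply: (@sunit_dvd_h c 0); exists c^-1; rewrite expr0 mulrV. Qed.

Lemma sunitT : sunit T.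
Proof.
exists 1, 1, 1, 0; split; try exact: rdvd_refl.
by rewrite expr1z divff ?mulr1 // k0 oner_eq0.
Qed.

Lemma sunitM u w : sunit u -> sunit w -> sunit (u * w).
Proof.
case=> i [a [b [n [da db ->]]]] [j [c [d [m [dc dd ->]]]]].
exists (i + j), (a * c), (b * d), (n + m)%N; split; try exact: dvd_hXM.
rewrite expfzDr // mulrACA; congr (_ * _).
by rewrite !polyCM !rmorphM invfM /= mulrACA.
Qed.

Lemma sunitV u : sunit u -> sunit u^-1.
Proof.
case=> i [a [b [n [da db ->]]]]; exists (- i), b, a, n; split=> //.
by rewrite !invfM invrK [k b * _]mulrC invr_expz.
Qed.

Lemma sunitF u w : sunit u -> sunit w -> sunit (u / w).
Proof. by move=> uu uw; apply/sunitM/sunitV. Qed.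

Lemma sunitX u n : sunit u -> sunit (u ^+ n).
Proof.
move=> uu; elim: n => [|n IH]; first by rewrite expr0; apply: sunit1.
by rewrite exprS; apply: sunitM.
Qed.

Lemma sunitXz u (i : int) : sunit u -> sunit (u ^ i).
Proof. by case: i => n uu; [|apply: sunitV]; apply: sunitX. Qed.

Lemma sunit_s u : sunit u -> sunit (s u).
Proof.
case=> i [a [b [n [da db ->]]]].
rewrite rmorphM fmorph_div /= !sA rmorphXz ?unitfE // sTE.
apply: sunitM; last by apply: sunitF; apply: sunit_dvd_h; [exact: da|exact: db].
apply/sunitXz/sunitF/sunitT; apply: (@sunit_dvd_h h 1); exact: rdvd_refl.
Qed.

Section Good.
Variable p : {poly A}.
Hypothesis gp : good p.

Let pp : prime_elt p. Proof. by case: gp. Qed.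

Lemma good_ndvd a n : rdvd a (h ^+ n) -> ~ rdvd p a%:P.
Proof.
move=> da pa; case: gp => _ _; apply; apply: (@prime_dvd_exp _ _ _ n) => //.
by rewrite -polyC_exp; apply: rdvd_trans pa _; apply/rdvd_polyC.
Qed.

Lemma sunit_num u : sunit u ->
  exists x y, [/\ ~ rdvd p x, ~ rdvd p y & u = io x / io y].
Proof.
case=> i [a [b [n [da db ->]]]]; have [_ pX _] := gp.
have pXn m : ~ rdvd p ('X^m) by move/(prime_dvd_exp pp).
have b0 : k b != 0 by rewrite k0; apply: dvd_hX db.
case: i => m.
  exists ('X^m * a%:P)%R, b%:P; split; last 1 first.
  - by rewrite rmorphM rmorphXn /= -exprnP mulrA.
  - by apply: ndvdM => //; apply: good_ndvd da.
  - exact: good_ndvd db.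
exists a%:P, ('X^(m.+1) * b%:P)%R; split; last 1 first.
- rewrite NegzE -exprnN rmorphM rmorphXn /=.
  by have := expf_neq0 m.+1 T0; move: (T ^+ m.+1) => t t0; field; rewrite ?t0 ?b0.
- exact: good_ndvd da.
- by apply: ndvdM => //; apply: good_ndvd db.
Qed.

(** Divisibility by p in the localization. *)
Definition ldvd (z : F) := exists u c, sunit u /\ z = u * io (p * c).

Lemma ldvdE a : ldvd (io a) -> rdvd p a.
Proof.
case=> u [c [/sunit_num[x [y [px py ->]]]] e].
have y0 : io y != 0 by rewrite io0; apply: ndvd_neq0 py.
have e' : y * a = x * (p * c).
  by apply: io_inj; rewrite !rmorphM /= e !rmorphM /=; field.
have : rdvd p (y * a) by rewrite e'; apply/rdvd_mull/rdvd_mulr/rdvd_refl.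
by case: pp => _ _ pM /pM[].
Qed.

End Good.

Lemma good_neq0 p : good p -> io p != 0.
Proof. by case=> -[p0 _ _] _ _; rewrite io0. Qed.

Lemma good_assoc p q : good p -> good q -> rdvd p q ->
  exists2 u, sunit u & io q = u * io p.
Proof.
case=> pp _ _ [qq _ _] /(prime_assoc pp qq)[c cu ->].
exists (io c); last by rewrite mulrC rmorphM.
move: cu; rewrite poly_unitE => /andP[/size_poly1P[c' c'0 ->]].
by rewrite coefC /=; apply: sunit_constant.
Qed.

Definition iop (r : seq {poly A}) := io (\prod_(p <- r) p).

Lemma iop_nil : iop [::] = 1.
Proof. by rewrite /iop big_nil rmorph1. Qed.

Lemma iop_cons p r : iop (p :: r) = io p * iop r.
Proof. by rewrite /iop big_cons rmorphM. Qed.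

Lemma iop_cat r t : iop (r ++ t) = iop r * iop t.
Proof. by rewrite /iop big_cat rmorphM. Qed.

Lemma iop_rem p r : p \in r -> iop r = io p * iop (rem p r).
Proof. by move=> pr; rewrite -iop_cons /iop (perm_big _ (perm_to_rem pr)). Qed.

Definition goods (r : seq {poly A}) := {in r, forall p, good p}.

Lemma goods_cons p r : goods (p :: r) -> good p /\ goods r.
Proof.
move=> g; split; first by apply: g; rewrite inE eqxx.
by move=> q qr; apply: g; rewrite inE qr orbT.
Qed.

Lemma goods_rem p r : goods r -> goods (rem p r).
Proof. by move=> g q /mem_rem/g. Qed.

Lemma iop_neq0 r : goods r -> iop r != 0.
Proof.
elim: r => [_|p r IH /goods_cons[gp gr]]; first by rewrite iop_nil oner_eq0.
by rewrite iop_cons mulf_neq0 ?IH ?good_neq0.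
Qed.

(** The primes that are not good become units once T and h are inverted. *)
Lemma bad_prime p : prime_elt p -> ~ good p -> sunit (io p).
Proof.
move=> pp ngp; have [p0 pu _] := pp.
have [[c e]|pX] := pselect (rdvd p 'X); last first.
  have [[c e]|ph] := pselect (rdvd p h%:P); last by case: ngp.
  have c0 : c != 0.
    by apply: contraTneq h0 => c0; rewrite -polyC_eq0 e c0 mulr0 eqxx.
  have : (size p <= 1)%N.
    have := congr1 (size \o val) e; rewrite /= size_polyC h0 size_mul //.
    by have := c0; rewrite -size_poly_gt0; case: (size c) => // n _ /=; rewrite addnS /= => ->; rewrite leq_addr.
  move=> sp; have := size1_polyC sp => def_p; rewrite def_p.
  apply: (@sunit_dvd_h _ 1); rewrite expr1; apply/rdvd_polyC.
  by rewrite -def_p; exists c.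
have c0 : c != 0.
  by apply: contraNneq (negbT (polyX_eq0 A)) => c0; rewrite e c0 mulr0.
have szX := congr1 (size \o val) e; rewrite /= size_polyX size_mul // in szX.
have [sp|sp] := leqP (size p) 1.
  case/negP: pu; have def_p := size1_polyC sp.
  have e1 : 1 = p`_0 * c`_1.
    have := congr1 (fun q : {poly A} => q`_1) e.
    by rewrite coefX [in RHS]def_p coefCM.
  by rewrite def_p; apply: polyC_unit; apply/unitrPr; exists c`_1.
have sc : (size c <= 1)%N by lia.
have def_c := size1_polyC sc.
have e1 : 1 = p`_1 * c`_0.
  have := congr1 (fun q : {poly A} => q`_1) e.
  by rewrite coefX [in RHS]def_c coefMC.
have cu : c`_0 \is a GRing.unit by apply/unitrPr; exists p`_1; rewrite mulrC.
have -> : io p = T * (k c`_0)^-1.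
  by rewrite e def_c coefC /= rmorphM mulfK // k0 -polyC_eq0 -def_c.
exact: sunitF sunitT (sunit_constant cu).
Qed.

Lemma good_factorization a : a != 0 ->
  exists u r, [/\ sunit u, goods r & io a = u * iop r].
Proof.
move=> /ufdX[c [r [cu pr ->]]]; elim: r pr => [_|p r IH pr].
  exists (io c), [::]; split=> //; last by rewrite iop_nil big_nil rmorphM rmorph1.
  move: cu; rewrite poly_unitE => /andP[/size_poly1P[c' c'0 ->]].
  by rewrite coefC /=; apply: sunit_constant.
have [|u [t [uu gt e]]] := IH; first by move=> q qr; apply: pr; rewrite inE qr orbT.
have pp : prime_elt p by apply: pr; rewrite inE eqxx.
rewrite big_cons mulrCA rmorphM e; have [gp|ngp] := pselect (good p).
  exists u, (p :: t); split=> //; last by rewrite iop_cons mulrCA.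
  by move=> q; rewrite inE => /predU1P[->|/gt].
exists (io p * u), t; split=> //; last by rewrite mulrA.
exact: sunitM (bad_prime pp ngp) uu.
Qed.

Lemma good_fraction f : f != 0 -> exists u r t,
  [/\ sunit u, goods r, goods t & f = u * (iop r / iop t)].
Proof.
have [a [b [b0 ->]]] := io_frac f => f0.
have a0 : a != 0 by apply: contraNneq f0 => ->; rewrite rmorph0 mul0r.
have [u [r [uu gr ->]]] := good_factorization a0.
have [w [t [uw gt ->]]] := good_factorization b0.
exists (u / w), r, t; split=> //; first exact: sunitF.
by rewrite invfM mulrACA.
Qed.

Lemma good_dvd_iop p r z u : good p -> goods r -> sunit u ->
  iop r = u * io p * io z -> exists2 q, q \in r & rdvd p q.
Proof.
move=> gp gr uu e; have [pp _ _] := gp; apply: (prime_dvd_prod pp).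
by apply: (ldvdE gp); exists u, z; split=> //; rewrite rmorphM mulrA -e.
Qed.

Lemma iop_sunit r : goods r -> sunit (iop r) -> r = [::].
Proof.
case: r => // p r /goods_cons[gp gr] ur; exfalso.
have [pp _ _] := gp; case: (prime_ndvd_unit pp (unitr1 _)).
apply: (ldvdE gp); exists (iop (p :: r))^-1, (\prod_(q <- r) q); split; first exact: sunitV.
by rewrite rmorph1 rmorphM -/(iop r) -iop_cons mulVf // sunit_neq0.
Qed.

(** Substituting h / T for T in a polynomial only introduces powers of T as
    denominators. *)
Lemma s_poly P : exists Q d, s (io P) = io Q / T ^+ d.
Proof.
elim/poly_ind: P => [|P c [Q [d e]]]; first by exists 0, 0%N; rewrite !rmorph0 mul0r.
exists (Q * h%:P + c%:P * 'X^(d.+1)), d.+1.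
rewrite !rmorphD !rmorphM /= rmorphXn /= sA e sTE exprS.
by have := expf_neq0 d T0; have := T0; move: (T ^+ d) => t T1 t1; field; rewrite ?T1 ?t1.
Qed.

Lemma s_good_factors p : good p -> exists u r,
  [/\ sunit u, goods r, s (io p) = u * iop r & (0 < size r)%N].
Proof.
move=> gp; have [Q [d e]] := s_poly p.
have Q0 : Q != 0.
  have : s (io p) != 0 by rewrite s0 good_neq0.
  by rewrite e; apply: contraNneq => ->; rewrite rmorph0 mul0r.
have [u [r [uu gr eQ]]] := good_factorization Q0.
exists (u / T ^+ d), r; split=> //; first exact/sunitF/sunitX/sunitT.
  by rewrite e eQ mulrAC.
case: r gr eQ => // _; rewrite iop_nil mulr1 => eQ.
have : sunit (io p).
  by rewrite -[io p]sK; apply: sunit_s; rewrite e eQ; exact/sunitF/sunitX/sunitT.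
have -> : io p = iop [:: p] by rewrite iop_cons iop_nil mulr1.
have g1 : goods [:: p] by move=> q; rewrite inE => /eqP->.
by move/(iop_sunit g1).
Qed.

Lemma s_good_list r : goods r -> exists u t,
  [/\ sunit u, goods t, s (iop r) = u * iop t & (size r <= size t)%N].
Proof.
elim: r => [_|p r IH /goods_cons[gp /IH[u [t [uu gt e le_rt]]]]].
  by exists 1, [::]; rewrite iop_nil rmorph1 mulr1; split=> //; exact: sunit1.
have [w [t1 [uw gt1 e1 lt_t1]]] := s_good_factors gp.
exists (w * u), (t1 ++ t); split; first exact: sunitM.
- by move=> q; rewrite mem_cat => /orP[/gt1|/gt].
- by rewrite iop_cons rmorphM e e1 iop_cat mulrACA.
- by rewrite size_cat /= -add1n leq_add.
Qed.

Lemma good_single p r u : good p -> goods r -> sunit u ->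
  io p = u * iop r -> size r = 1.
Proof.
move=> gp gr uu e; have u0 := sunit_neq0 uu.
have [|q qr pq] := @good_dvd_iop p r 1 u^-1 gp gr (sunitV uu).
  by rewrite rmorph1 mulr1 e mulKf.
have [w uw eq] := good_assoc gp (gr _ qr) pq.
have /iop_sunit : sunit (iop (rem q r)).
  have -> : iop (rem q r) = (u * w)^-1; last exact/sunitV/sunitM.
  apply: (mulfI (good_neq0 (gr _ qr))); rewrite -iop_rem // eq e.
  have w0 := sunit_neq0 uw.
  by field; rewrite ?u0 ?w0.
move=> /(_ (goods_rem gr)) e0; have := size_rem qr; rewrite e0 /=.
by move: qr; case: (r) => // x [].
Qed.

(** s is an involution that sends a good prime to a nonempty product of good
    primes; by unique factorization the product has a single factor. *)
Lemma s_good p : good p -> exists q,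
  good q /\ exists2 u, sunit u & s (io p) = u * io q.
Proof.
move=> gp; have [u [r [uu gr e lt_r]]] := s_good_factors gp.
have [w [t [uw gt et le_rt]]] := s_good_list gr.
have e1 : io p = s u * w * iop t by rewrite -[LHS]sK e rmorphM /= et mulrA.
have t1 := good_single gp gt (sunitM (sunit_s uu) uw) e1.
case: r gr e {et} lt_r le_rt => // q [|q' r] gr e _; last by rewrite t1.
move=> _; exists q; split; first by apply: gr; rewrite inE eqxx.
by exists u => //; rewrite e iop_cons iop_nil mulr1.
Qed.

(** The conjugate prime, which s determines up to a unit. *)
Definition star p := if pselect (good p) is left g then projT1 (cid (s_good g)) else p.

Lemma starP p : good p ->
  good (star p) /\ exists2 u, sunit u & s (io p) = u * io (star p).
Proof.
move=> gp; rewrite /star; case: pselect => // g.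
exact: (projT2 (cid (s_good g))).
Qed.

Lemma star_list r : goods r -> goods (map star r) /\
  exists2 u, sunit u & s (iop r) = u * iop (map star r).
Proof.
elim: r => [_|p r IH /goods_cons[gp /IH[gt [u uu e]]]].
  by split=> //; exists 1; rewrite ?iop_nil ?rmorph1 ?mulr1 //; exact: sunit1.
have [gs [w uw ew]] := starP gp; split.
  by move=> q; rewrite inE => /predU1P[->|/gt].
exists (w * u); first exact: sunitM.
by rewrite !iop_cons rmorphM e ew mulrACA.
Qed.

(** When p is associate to its conjugate, s preserves both the powers of p and the
    elements prime to p. *)
Lemma order_s p : good p -> rdvd (star p) p ->
  forall z, order io p (s z) = order io p z.
Proof.
move=> gp pq z; have [pp _ _] := gp; have P0 := good_neq0 gp.
have [->|z0] := eqVneq z 0; first by rewrite rmorph0.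
have [gq [w uw ew]] := starP gp; have [x ux ex] := good_assoc gq gp pq.
have x0 := sunit_neq0 ux.
have spE : s (io p) = (w / x) * io p by rewrite ew ex; field.
have uwx := sunitF uw ux.
have s_ndvd a : ~ rdvd p a -> exists Q d, ~ rdvd p Q /\ s (io a) = io Q / T ^+ d.
  move=> pa; have [Q [d e]] := s_poly a; exists Q, d; split=> // -[c eQ].
  apply: pa; apply: (ldvdE gp); have [R [d' e']] := s_poly c.
  exists (w / x / (T ^+ d' * s T ^+ d)), R; split.
    by apply: sunitF uwx _; apply: sunitM; apply: sunitX; [|apply: sunit_s]; exact: sunitT.
  rewrite -[LHS]sK e eQ fmorph_div rmorphXn !rmorphM /= spE e'.
  have sT0 : s T != 0 by rewrite s0.
  have := expf_neq0 d sT0; have := expf_neq0 d' T0.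
  by move: (T ^+ d') (s T ^+ d) => y1 y2 y10 y20; field; rewrite ?x0 ?y10 ?y20.
apply: (orderE ufdX io_inj io_frac pp).
have [a [b [pa pb ez]]] := orderP ufdX io_inj io_frac pp z0.
have [Q [d [pQ eQ]]] := s_ndvd a pa; have [R [d' [pR eR]]] := s_ndvd b pb.
set K := order io p z in ez *.
have uv : sunit ((w / x) ^ K * (T ^+ d' / T ^+ d)).
  by apply: sunitM; [apply: sunitXz|apply: sunitF; apply: sunitX; exact: sunitT].
have [v1 [v2 [p1 p2 ev]]] := sunit_num gp uv.
exists (v1 * Q), (v2 * R); split; try exact: ndvdM.
rewrite ez rmorphM rmorphXz ?unitfE // fmorph_div /= spE eQ eR expfzMl !rmorphM.
have R0 : io R != 0 by rewrite io0; apply: ndvd_neq0 pR.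
have v20 : io v2 != 0 by rewrite io0; apply: ndvd_neq0 p2.
have -> : io v1 * io Q / (io v2 * io R) = (io v1 / io v2) * (io Q / io R).
  by field; rewrite ?R0 ?v20.
rewrite -ev; have := expf_neq0 d T0; have := expf_neq0 d' T0.
move: (T ^+ d) (T ^+ d') => t t' t0 t'0.
by move: ((w / x) ^ K) (io p ^ K) => y1 y2; field; rewrite ?R0 ?t0 ?t'0.
Qed.

(** * Classes modulo norms *)

Notation norm f := (f * s f).

Let normM f g : norm (f * g) = norm f * norm g.
Proof. by rewrite rmorphM mulrACA. Qed.

Lemma iop_cancel p r : good p -> goods r -> (exists2 q, q \in r & rdvd p q) ->
  exists u t, [/\ sunit u, goods t, (size t < size r)%N & iop r = u * io p * iop t].
Proof.
move=> gp gr [q qr /(good_assoc gp (gr _ qr))[u uu e]].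
exists u, (rem q r); split=> //; first exact: goods_rem.
  by rewrite size_rem //; case: (r) qr.
by rewrite (iop_rem qr) e.
Qed.

(** An invariant of even type is a norm times a unit: a good prime factor p
    occurs together with its conjugate, because either the conjugate is another
    prime or p is invariant and its multiplicity is even. *)
Lemma even_norm_sunit e : e != 0 -> s e = e -> even_elt s e ->
  exists f u, [/\ sunit u, s u = u & e = norm f * u].
Proof.
have [a [b [b0 def_e]]] := io_frac e => e0 se evn.
have a0 : a != 0 by apply: contraNneq e0 => a0; rewrite def_e a0 rmorph0 mul0r.
have B0 : io b != 0 by rewrite io0.
have sB0 : s (io b) != 0 by rewrite s0.
suff H N r u x : (size r <= N)%N -> goods r -> sunit u -> x = u * iop r ->
    s x = x -> even_elt s x -> exists f w, [/\ sunit w, s w = w & x = norm f * w].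
  have [R [d eR]] := s_poly b.
  have R0 : R != 0 by rewrite -io0; apply: contraNneq sB0 => R0; rewrite eR R0 mul0r.
  have [u [r [uu gr ea]]] := good_factorization a0.
  have [v [t [uv gt eR']]] := good_factorization R0.
  have [|||||f [w [uw sw ef]]] :=
      @H _ (r ++ t) (u * v / T ^+ d) (e * norm (io b)) (leqnn _).
  - by move=> q; rewrite mem_cat => /orP[/gr|/gt].
  - by apply: sunitF; [exact: sunitM|exact/sunitX/sunitT].
  - rewrite iop_cat def_e mulrA mulfVK // ea eR eR'.
    by have := expf_neq0 d T0; move: (T ^+ d) => T' T'0; field.
  - by rewrite !rmorphM /= se sK [s _ * _]mulrC.
  - move=> nu valnu snu; have [i ei] := evn nu valnu snu.
    exists (i + nu (io b)).
    by rewrite valM ?mulf_neq0 // ei valM // snu addrACA.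
  exists (f / io b), w; split=> //.
  apply: (mulIf (mulf_neq0 B0 sB0)); rewrite ef fmorph_div.
  by field; rewrite ?B0 ?sB0.
elim: N r u x => [|N IH] [|p r] u x //=.
- by move=> _ _ uu ->; rewrite iop_nil mulr1 => su _; exists 1, u; rewrite rmorph1 !mul1r.
- by move=> _ _ uu ->; rewrite iop_nil mulr1 => su _; exists 1, u; rewrite rmorph1 !mul1r.
rewrite ltnS => le_r gpr uu def_x sx ev_x; have [gp gr] := goods_cons gpr.
have [pp _ _] := gp; have [gq [w uw ew]] := starP gp.
have Q0 := good_neq0 gq; have P0 := good_neq0 gp; have w0 := sunit_neq0 uw.
have u0 := sunit_neq0 uu.
have x0 : x != 0 by rewrite def_x mulf_neq0 ?iop_neq0.
have qr : exists2 q, q \in r & rdvd (star p) q.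
  have [pq|npq] := pselect (rdvd (star p) p); last first.
    have [gt [v uv ev]] := star_list gpr.
    have v0 := sunit_neq0 uv; have su0 := sunit_neq0 (sunit_s uu).
    have [||q] := @good_dvd_iop (star p) (p :: r) (\prod_(q <- map star r) q)
        (s u * v / u) gq gpr.
    + by apply: sunitF => //; apply: sunitM => //; apply: sunit_s.
    + apply: (mulfI u0); rewrite -def_x -[in LHS]sx def_x rmorphM ev -/(iop _).
      by rewrite /= iop_cons; field.
    by rewrite inE => /predU1P[-> /npq|qr dq] //; exists q.
  apply: contrapT => nqr.
  have ndp : ~ rdvd p (\prod_(q <- r) q).
    move/(prime_dvd_prod pp) => [q qr dq]; apply: nqr; exists q => //.
    exact: rdvd_trans pq dq.
  have [|k ek] := ev_x _ (order_valuation ufdX io_inj io_frac pp).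
    exact: order_s.
  have [x1 [x2 [p1 p2 eu]]] := sunit_num gp uu.
  have o1 : order io p x = 1.
    apply: (orderE ufdX io_inj io_frac pp); exists (x1 * \prod_(q <- r) q), x2.
    split=> //; first exact: ndvdM.
    by rewrite def_x iop_cons eu expr1z rmorphM /iop mulrCA mulrAC.
  exact: one_not_double (etrans (esym o1) ek).
have [v [t [uv gt lt_t et]]] := iop_cancel gq gr qr.
have v0 := sunit_neq0 uv.
have nP0 : norm (io p) != 0 by rewrite mulf_neq0 // s0.
have [|||||f [z [uz sz ez]]] := IH t (u * v / w) (x / norm (io p)) _ gt.
- exact: leq_trans (ltnW lt_t) le_r.
- by apply: sunitF => //; apply: sunitM.
- by rewrite def_x iop_cons et ew; field; rewrite ?w0 ?P0 ?Q0.
- by rewrite fmorph_div sx !rmorphM /= sK [s _ * _]mulrC.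
- move=> nu valnu snu; have [i ei] := ev_x nu valnu snu.
  exists (i - nu (io p)).
  by rewrite valM ?invr_eq0 // valV // ei valM ?s0 // snu opprD addrACA.
exists (f * io p), z; split=> //.
by rewrite normM mulrAC -ez mulfVK.
Qed.

(** The theorem of Hilbert 90 at the level of divisors: if the norm of f has no
    good prime factor, then the divisor of f is D - s D, so that f is a unit times
    a quotient s g / g, which has norm 1. *)
Lemma sunit_norm f : f != 0 -> sunit (norm f) ->
  exists2 u, sunit u & norm f = norm u.
Proof.
move=> f0; have [u [r [t [uu gr gt ef]]]] := good_fraction f0.
have [N] := ubnP (size r + size t).
elim: N u r t f {f0} ef uu gr gt => // N IH u r t f ef uu gr gt /ltnSE-le_N uf.
have [gr' [ur uur er]] := star_list gr; have [gt' [ut uut et]] := star_list gt.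
have ur0 := sunit_neq0 uur; have ut0 := sunit_neq0 uut; have u0 := sunit_neq0 uu.
have su0 := sunit_neq0 (sunit_s uu).
have r0 := iop_neq0 gr; have t0 := iop_neq0 gt.
have r'0 := iop_neq0 gr'; have t'0 := iop_neq0 gt'.
have enorm : norm f = u * s u * (ur / ut) *
    (iop r * iop (map star r) / (iop t * iop (map star t))).
  by rewrite ef rmorphM fmorph_div er et /=; field; rewrite ?ur0 ?ut0 ?t0 ?t'0.
have uc : sunit (u * s u * (ur / ut)).
  by apply: sunitM; [apply: sunitM => //; apply: sunit_s | apply: sunitF].
have c0 := sunit_neq0 uc; have f0 := sunit_neq0 uf.
have gtt : goods (t ++ map star t).
  by move=> q; rewrite mem_cat => /orP[/gt|/gt'].
have ett : iop (t ++ map star t) =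
    (u * s u * (ur / ut) / norm f) * (iop r * iop (map star r)).
  rewrite iop_cat; apply: (mulfI f0); rewrite {1}enorm.
  move: (norm f) f0 => nf nf0; field.
  by rewrite ?nf0 ?ur0 ?ut0 ?t0 ?t'0.
case: r => [|p r] in ef gr le_N er gr' r0 r'0 enorm ett *.
  have t_nil : t ++ map star t = [::].
    by apply: iop_sunit gtt _; rewrite ett /= !iop_nil !mulr1; apply: sunitF.
  exists u => //; move: ef t_nil; case: (t) => // ->.
  by rewrite iop_nil divff ?oner_eq0 // mulr1.
have [gp gr1] := goods_cons gr; have P0 := good_neq0 gp.
have [||q qt pq] := @good_dvd_iop p _ (\prod_(q <- r ++ map star (p :: r)) q)
    (u * s u * (ur / ut) / norm f) gp gtt.
- exact: sunitF.
- by rewrite ett iop_cons -[in RHS]/(iop _) iop_cat !mulrA.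
move: qt; rewrite mem_cat => /orP[qt|/mapP[q' qt def_q]].
  have [v uv eq] := good_assoc gp (gt _ qt) pq; have v0 := sunit_neq0 uv.
  apply: (IH (u / v) r (rem q t) f) => //.
  + rewrite ef (iop_rem qt) iop_cons eq.
    have := iop_neq0 (goods_rem (p := q) gt).
    by move: (iop (rem q t)) => y y0; field; rewrite ?v0 ?P0 ?y0.
  + exact: sunitF.
  + exact: goods_rem.
  + apply: leq_trans le_N; rewrite /= addSn ltnS leq_add2l size_rem //; exact: leq_pred.
have gq' := gt _ qt; have [gq [w uw ew]] := starP gq'.
rewrite def_q in pq; have [v uv eq] := good_assoc gp gq pq.
have v0 := sunit_neq0 uv; have w0 := sunit_neq0 uw; have Q0 := good_neq0 gq'.
have sQ0 : s (io q') != 0 by rewrite s0.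
have sP : io p = s (io q') / (w * v) by rewrite ew eq; field; rewrite ?w0 ?v0.
pose f1 := f * (io q' / s (io q')).
have nf1 : norm f1 = norm f.
  rewrite /f1 normM [X in _ * X](_ : _ = 1) ?mulr1 // fmorph_div sK.
  by field; rewrite ?Q0 ?sQ0.
have [||||||x ux ex] := IH (u / (w * v)) r (rem q' t) f1.
- rewrite /f1 ef (iop_rem qt) iop_cons sP.
  have := iop_neq0 (goods_rem (p := q') gt).
  by move: (iop (rem q' t)) => y y0; field; rewrite ?v0 ?w0 ?Q0 ?sQ0 ?y0.
- by apply: sunitF => //; apply: sunitM.
- by [].
- exact: goods_rem.
- apply: leq_trans le_N; rewrite /= addSn ltnS leq_add2l size_rem //; exact: leq_pred.
- by rewrite nf1.
by exists x; rewrite // -nf1.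
Qed.

(** The exponent of T in a unit counts modulo 2 only, since norm T = h. *)
Lemma norm_of_sunit u : sunit u -> exists (d : bool) a b,
  [/\ a != 0, b != 0 & norm u * k (b ^+ 2) = k (h ^+ d * a ^+ 2)].
Proof.
case=> i [a [b [n [da db ->]]]].
have a0 := dvd_hX da; have b0 := dvd_hX db.
have H0 : k h != 0 by rewrite k0.
have B0 : k b != 0 by rewrite k0.
have -> : norm (T ^ i * (k a / k b)) = k h ^ i * (k a / k b) ^+ 2.
  rewrite rmorphM rmorphXz ?unitfE // fmorph_div !sA mulrACA -expfzMl sT.
  by rewrite expr2.
have [j [d ->]] : exists (j : int) (d : bool), i = j + j + d%:Z.
  case: i => m.
    by exists m./2%:Z, (odd m); have := odd_double_half m; lia.
  exists (- (m.+2)./2%:Z), (odd m.+1); have := odd_double_half m.+1; lia.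
rewrite !expfzDr // -exprnP; case: j => m.
  exists d, (h ^+ m * a), b; split=> //; first by rewrite mulf_neq0 ?expf_neq0.
  rewrite !(polyCM, polyC_exp) !(rmorphM, rmorphXn).
  by rewrite /= -exprnP; field.
exists d, a, (h ^+ m.+1 * b); split=> //; first by rewrite mulf_neq0 ?expf_neq0.
rewrite !(polyCM, polyC_exp) !(rmorphM, rmorphXn).
rewrite /= NegzE -exprnN.
by have := expf_neq0 m.+1 H0; move: (k h ^+ m.+1) => y y0; field; rewrite ?y0 ?B0.
Qed.

Lemma invariant_sunit u : sunit u -> s u = u ->
  exists g a n, [/\ g != 0, a != 0, rdvd a (h ^+ n) & u = norm g * k a].
Proof.
case=> i [a [b [n [da db ->]]]]; have a0 := dvd_hX da; have b0 := dvd_hX db.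
have H0 : k h != 0 by rewrite k0.
have B0 : k b != 0 by rewrite k0.
have A0 : k a != 0 by rewrite k0.
rewrite rmorphM rmorphXz ?unitfE // fmorph_div !sA.
move/(mulIf (mulf_neq0 A0 (invr_neq0 B0))); rewrite sTE => e.
have {}e : k h ^ i = T ^ i * T ^ i.
  by rewrite -{1}e -expfzMl mulfVK.
have X2 m : T ^+ m * T ^+ m = k h ^+ m -> m = 0.
  rewrite -!rmorphXn -rmorphM -exprD => /io_inj/(congr1 (size \o val)).
  by rewrite /= size_polyXn size_polyC; case: (h ^+ m != 0); case: m.
have i0 : i = 0.
  case: i e => m e; first by rewrite (X2 m).
  suff /X2 : T ^+ m.+1 * T ^+ m.+1 = k h ^+ m.+1 by [].
  by move: e; rewrite NegzE -!exprnN -invfM => /invr_inj.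
exists (k b)^-1, (a * b), (n + n)%N; split; first by rewrite invr_eq0.
- by rewrite mulf_neq0.
- exact: dvd_hXM.
by rewrite i0 expr0z mul1r fmorphV sA polyCM rmorphM; field.
Qed.

(** The squarefree representative of a product of elements of r, modulo squares. *)
Definition parity_prod (r : seq A) (J : {ffun 'I_(size r) -> bool}) :=
  \prod_(j < size r) r`_j ^+ J j.

Lemma dvd_power_class (r : seq A) c a n : c \is a GRing.unit ->
    {in r, forall p, prime_elt p} -> h = c * \prod_(p <- r) p ->
    (forall c : A, c \is a GRing.unit -> exists d, c = d ^+ 2) ->
    rdvd a (h ^+ n) ->
  exists b J, a = b ^+ 2 * @parity_prod r J.
Proof.
move=> cu pr def_h sq da; have a0 := dvd_hX da.
have [d [t [du pt def_a]]] := ufdA a0.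
have {}pt : {in t, forall p, exists j : 'I_(size r), exists2 u, u \is a GRing.unit & p = r`_j * u}.
  move=> p pt'; have pp := pt _ pt'.
  have : rdvd p h.
    apply: (@prime_dvd_exp _ _ _ n) => //; apply: rdvd_trans da.
    rewrite def_a (perm_big _ (perm_to_rem pt')) big_cons.
    exact/rdvd_mull/rdvd_mulr/rdvd_refl.
  rewrite def_h; have [_ _ pM] := pp; case/pM => [/(prime_ndvd_unit pp cu)//|].
  case/(prime_dvd_prod pp) => q qr /(prime_assoc pp (pr _ qr))[u uu eq].
  have lt_q : (index q r < size r)%N by rewrite index_mem.
  exists (Ordinal lt_q), u^-1; first by rewrite unitrV.
  by rewrite /= nth_index // eq mulrK.
rewrite {a da a0}def_a; elim: t pt => [|p t IH] pt.
  have [b ->] := sq _ du; exists b, [ffun=> false].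
  rewrite big_nil /parity_prod big1 ?mulr1 // => j _.
  by rewrite ffunE expr0.
have [j [u uu ->]] := pt p (mem_head _ _).
have [v ->] := sq _ uu.
have [q qt|b [J e]] := IH; first by apply: pt; rewrite inE qt orbT.
rewrite big_cons mulrCA e.
exists (v * b * (if J j then r`_j else 1)), [ffun i => (i == j) (+) J i].
rewrite /parity_prod (bigD1 j) //= [in RHS](bigD1 j) //= ffunE eqxx /=.
rewrite [in RHS](eq_bigr (fun i => r`_(i : 'I__) ^+ J i)); last first.
  by move=> i /negbTE ij; rewrite ffunE ij.
by case: (J j) => /=; rewrite ?expr0 ?expr1; ring.
Qed.

(** Each class contains a squarefree product of prime factors of h. *)
Theorem finitely_many_classes :
    (forall c : A, c \is a GRing.unit -> exists d, c = d ^+ 2) ->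
  exists m, forall M, many_classes s M -> (M <= m)%N.
Proof.
move=> sq; have [c [r [cu pr def_h]]] := ufdA h0.
exists #|{ffun 'I_(size r) -> bool}| => M [e [he inj_e]].
have class i : exists J f, e i = norm f * k (@parity_prod r J).
  have [e0 se ev] := he i.
  have [f [u [uu su ef]]] := even_norm_sunit e0 se ev.
  have [g [a [n [g0 a0 da eu]]]] := invariant_sunit uu su.
  have [b [J ea]] := dvd_power_class cu pr def_h sq da.
  exists J, (f * g * k b).
  have -> : e i = norm f * (norm g * (k b ^+ 2 * k (parity_prod J))).
    by rewrite ef eu ea; congr (_ * (_ * _)); rewrite polyCM polyC_exp rmorphM rmorphXn.
  by rewrite !(rmorphM s) /= sA; ring.
pose J i := projT1 (cid (class i)).
have JP i : exists f, e i = norm f * k (parity_prod (J i)).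
  exact: (projT2 (cid (class i))).
suff /leq_card : injective J by rewrite card_ord.
move=> i j eJ; have [f ei] := JP i; have [g ej] := JP j.
have g0 : g != 0.
  by have [e0 _ _] := he j; apply: contraNneq e0 => g0; rewrite ej g0 !mul0r.
apply: (inj_e i j (f / g)); rewrite ei ej eJ rmorphM fmorphV /=.
have sg0 : s g != 0 by rewrite s0.
by field; rewrite ?g0 ?sg0.
Qed.

End ConicInvolution.

(** * Forms that are even *)

Section RootsOfUnity.
Variable C : numClosedFieldType.
Implicit Types z : C.

Lemma norm1_of_exp z N : (0 < N)%N -> `|z ^+ N| = 1 -> `|z| = 1.
Proof. by move=> N0; rewrite normrX => /eqP; rewrite pexpr_eq1 // => /eqP. Qed.

(** If z and - 1 - z both have modulus 1, then z is a primitive cube root of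
    unity. *)
Lemma sum_neq_unity_root z N n : (0 < n)%N -> (0 < N)%N -> coprime 3 N ->
  z ^+ N = -1 -> (- 1 - z) ^+ n != 1.
Proof.
move=> n0 N0 c3N zN; apply/eqP => wn.
have z1 : `|z| = 1 by apply: (norm1_of_exp N0); rewrite zN normrN normr1.
have w1 : `|- 1 - z| = 1 by apply: (norm1_of_exp n0); rewrite wn normr1.
have zz : z * z^* = 1 by rewrite -normCK z1 expr1n.
have ww : (- 1 - z) * (- 1 - z^*) = 1.
  transitivity (`|- 1 - z| ^+ 2); last by rewrite w1 expr1n.
  by rewrite normCK rmorphB rmorphN rmorph1.
have z2 : z ^+ 2 + z + 1 = 0.
  transitivity (z * ((- 1 - z) * (- 1 - z^*) - 1) - (z + 1) * (z * z^* - 1)); first by ring.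
  by rewrite ww zz !subrr !mulr0 subrr.
have z3 : z ^+ 3 = 1.
  apply/eqP; rewrite -subr_eq0; apply/eqP.
  by transitivity ((z - 1) * (z ^+ 2 + z + 1)); [ring | rewrite z2 mulr0].
have z2N : z ^+ (N * 2) = 1 by rewrite exprM zN sqrrN expr1n.
have z_1 : z = 1.
  have c3 : coprime 3 (N * 2) by rewrite coprimeMr c3N.
  have := egcdnP (N * 2) (isT : (0 < 3)%N); case=> a b e _.
  rewrite (eqP c3) in e.
  have : z ^+ (a * 3) = z ^+ (b * (N * 2) + 1) by rewrite e.
  by rewrite exprD mulnC exprM z3 expr1n mulnC exprM z2N expr1n mul1r expr1.
move: z2; rewrite z_1 expr1n => /eqP; rewrite -[1 + 1 + 1](natrD _ 2 1).
by rewrite pnatr_eq0.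
Qed.

(** The roots of X ^ N + 1 are simple roots of X ^ n - 1, and they are not roots of
    the second factor by the preceding lemma. *)
Lemma cofactor_coprime N n : (0 < n)%N -> (0 < N)%N -> coprime 3 N ->
  (N * 2 %| n)%N -> exists G : {poly C},
  ('X^N + 1) * G = ('X^n - 1) * ((- 1 - 'X) ^+ n - 1) /\ coprimep ('X^N + 1) G.
Proof.
move=> n0 N0 c3N /dvdnP[r def_n].
have [G1 eG1] : exists G1 : {poly C}, 'X^n - 1 = ('X^N + 1) * G1.
  exists (('X^N - 1) * \sum_(i < r) ('X^N ^+ 2) ^+ i).
  by rewrite mulrA -[(_ + 1) * _]mulrC -subr_sqr_1 -subrX1 -!exprM mulnA def_n [(N * 2 * r)%N]mulnC.
exists (G1 * ((- 1 - 'X) ^+ n - 1)); split; first by rewrite mulrA eG1.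
apply/Pdiv.ClosedField.coprimepP => z; rewrite rootE !(hornerE, hornerXn) => /eqP zN.
have {}zN : z ^+ N = -1 by apply/eqP; rewrite -addr_eq0 zN.
rewrite mulf_neq0 //; last first.
  rewrite subr_eq0; have := sum_neq_unity_root n0 N0 c3N zN.
  by rewrite ?(hornerE, horner_exp).
have := congr1 (fun p => p^`().[z]) eG1.
rewrite derivM !derivE !(hornerE, hornerMn, hornerXn) zN addNr mul0r addr0 subr0.
move=> e; apply/eqP => G0; move/eqP: e; rewrite G0 mulr0 -mulr_natr mulf_eq0.
rewrite pnatr_eq0 (gtn_eqF n0) orbF expf_eq0 => /andP[_ /eqP z0].
by move/eqP: zN; rewrite z0 expr0n (gtn_eqF N0) eq_sym oppr_eq0 oner_eq0.
Qed.

End RootsOfUnity.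

Lemma double_arith (a b c i : int) : b + b + (c + 0) = i + i ->
  a + a + c = a + i - b + (a + i - b).
Proof. lia. Qed.

Section EvenForms.
Variables (C : numClosedFieldType) (F : fieldType) (io : {rmorphism C -> F}).
Variable v : F -> int.
Hypothesis valv : valuation v.

(** Constants have roots of every order, so that their valuation is divisible by
    every integer. *)
Lemma val_cst c : c != 0 -> v (io c) = 0.
Proof.
move=> c0; set M := (absz (v (io c))).+1.
have M0 : (0 < M)%N by [].
have d0 : io (M.-root c) != 0 by rewrite fmorph_eq0 rootC_eq0.
have e : v (io c) = v (io (M.-root c)) *+ M.
  by rewrite -valX // -rmorphXn /= rootCK.
apply/eqP; rewrite -absz_eq0; apply/eqP.
move: e; rewrite /M; move: (v (io c)) (v (io (M.-root c))) => a b.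
rewrite -mulr_natr => e; move: (congr1 absz e); rewrite abszM natz absz_nat.
by case: (absz b) => [|t]; nia.
Qed.

Definition integral t := t = 0 \/ 0 <= v t.
Definition infinitesimal t := t = 0 \/ 0 < v t.

Lemma integralM a b : integral a -> integral b -> integral (a * b).
Proof.
have [->|a0] := eqVneq a 0; first by rewrite mul0r; left.
have [->|b0] := eqVneq b 0; first by rewrite mulr0; left.
case=> [a1|ha]; first by rewrite a1 eqxx in a0.
case=> [b1|hb]; first by rewrite b1 eqxx in b0.
by right; rewrite valM // addr_ge0.
Qed.

Lemma infinitesimalM a b : integral a -> infinitesimal b -> infinitesimal (a * b).
Proof.
have [->|a0] := eqVneq a 0; first by rewrite mul0r; left.
have [->|b0] := eqVneq b 0; first by rewrite mulr0; left.
case=> [a1|ha]; first by rewrite a1 eqxx in a0.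
case=> [b1|hb]; first by rewrite b1 eqxx in b0.
by right; rewrite valM // ltr_wpDl.
Qed.

Lemma integralD a b : integral a -> integral b -> integral (a + b).
Proof.
case=> [->|ha]; first by rewrite add0r.
case=> [->|hb]; first by rewrite addr0; right.
have [->|a0] := eqVneq a 0; first by rewrite add0r; right.
have [->|b0] := eqVneq b 0; first by rewrite addr0; right.
have [->|ab0] := eqVneq (a + b) 0; [by left|right].
by apply: le_trans (valD valv a0 b0 ab0); rewrite le_min ha.
Qed.

Lemma infinitesimalD a b :
  infinitesimal a -> infinitesimal b -> infinitesimal (a + b).
Proof.
case=> [->|ha]; first by rewrite add0r.
case=> [->|hb]; first by rewrite addr0; right.
have [->|a0] := eqVneq a 0; first by rewrite add0r; right.
have [->|b0] := eqVneq b 0; first by rewrite addr0; right.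
have [->|ab0] := eqVneq (a + b) 0; [by left|right].
by apply: lt_le_trans (valD valv a0 b0 ab0); rewrite lt_min ha.
Qed.

Lemma integral_horner z (p : {poly C}) : integral z ->
  integral (map_poly io p).[z].
Proof.
move=> iz; elim/poly_ind: p => [|p c IH]; first by rewrite map_poly0 horner0; left.
rewrite rmorphD rmorphM /= map_polyX map_polyC /= hornerMXaddC.
apply: integralD; first exact: integralM.
have [->|c0] := eqVneq c 0; first by rewrite rmorph0; left.
by right; rewrite val_cst.
Qed.

(** Two coprime polynomials cannot both have positive valuation at z. *)
Lemma coprime_valuation z (p q : {poly C}) : integral z -> coprimep p q ->
  (map_poly io p).[z] != 0 -> (map_poly io q).[z] != 0 ->
  v (map_poly io p).[z] = 0 \/ v (map_poly io q).[z] = 0.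
Proof.
move=> iz cpq p0 q0; have ge0 r : (map_poly io r).[z] != 0 -> 0 <= v (map_poly io r).[z].
  by move=> r0; case: (integral_horner r iz) => // r1; rewrite r1 eqxx in r0.
apply: contrapT => /not_orP[vp vq].
have vp0 : 0 < v (map_poly io p).[z] by rewrite lt_def ge0 // andbT; apply/eqP.
have vq0 : 0 < v (map_poly io q).[z] by rewrite lt_def ge0 // andbT; apply/eqP.
have [[a b] /= e] := Bezout_eq1_coprimepP p q cpq.
have : infinitesimal 1.
  rewrite (_ : 1 = (map_poly io (a * p + b * q)).[z]); last first.
    by rewrite e rmorph1 hornerC.
  rewrite rmorphD !rmorphM hornerD !hornerM.
  by apply: infinitesimalD; apply: infinitesimalM; try exact: integral_horner; right.
by case=> [/eqP|]; rewrite ?oner_eq0 // val1 // ltxx.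
Qed.

(** The form y^N + x^N has even degree and is coprime to its cofactor in the product
    of valuation i + i.  If x and y have the same valuation, then at most one of the
    two factors, divided by its power of x, has nonzero valuation. *)
Lemma even_form (x y : F) N n i : x != 0 -> y != 0 -> y ^+ N + x ^+ N != 0 ->
    (0 < n)%N -> (0 < N)%N -> coprime 3 N -> ~~ odd N -> (N * 2 %| n)%N ->
    (y ^+ n - x ^+ n) * ((- x - y) ^+ n - x ^+ n) != 0 ->
    v ((y ^+ n - x ^+ n) * ((- x - y) ^+ n - x ^+ n)) = i + i ->
  exists j, v (y ^+ N + x ^+ N) = j + j.
Proof.
move=> x0 y0 f0 n0 N0 c3N evN dvd_n H0 vH.
have xN0 := expf_neq0 N x0; have yN0 := expf_neq0 N y0.
have eN : N = (N./2 + N./2)%N by rewrite addnn even_halfK.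
have v_exp t : t != 0 -> v (t ^+ N) = v t *+ N./2 + v t *+ N./2.
  by move=> t0; rewrite valX // {1}eN mulrnDr.
have [lt_yx|lt_xy|e_xy] := ltgtP (v (y ^+ N)) (v (x ^+ N)).
- by have [_ ->] := valD_lt valv yN0 xN0 lt_yx; exists (v y *+ N./2); apply: v_exp.
- rewrite addrC; have [_ ->] := valD_lt valv xN0 yN0 lt_xy.
  by exists (v x *+ N./2); apply: v_exp.
have {}e_xy : v y = v x.
  have N0' : (N%:R : int) != 0 by rewrite pnatr_eq0 -lt0n.
  by move: e_xy; rewrite !valX // -[LHS]mulr_natr -[RHS]mulr_natr => /(mulIf N0').
pose z := y / x; have z0 : z != 0 by rewrite mulf_neq0 ?invr_eq0.
have vz : v z = 0 by rewrite valM ?invr_eq0 // valV // e_xy subrr.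
have iz : integral z by right; rewrite vz.
have [G [eG cG]] := cofactor_coprime C n0 N0 c3N dvd_n.
set p := 'X^N + 1 in eG cG.
have ep : y ^+ N + x ^+ N = x ^+ N * (map_poly io p).[z].
  rewrite rmorphD /= map_polyXn rmorph1 !(hornerE, hornerXn) mulrDr mulr1 -exprMn.
  by rewrite mulrC mulfVK.
have eH : (y ^+ n - x ^+ n) * ((- x - y) ^+ n - x ^+ n) =
    x ^+ n * x ^+ n * ((map_poly io p).[z] * (map_poly io G).[z]).
  have e1 : (map_poly io ('X^n - 1)).[z] = z ^+ n - 1.
    by rewrite rmorphB /= map_polyXn rmorph1 !(hornerE, hornerXn).
  have e2 : (map_poly io ((- 1 - 'X) ^+ n - 1)).[z] = (- 1 - z) ^+ n - 1.
    rewrite rmorphB rmorphXn rmorphB rmorphN !rmorph1 /= map_polyX.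
    by rewrite !(hornerE, horner_exp).
  rewrite -hornerM -rmorphM eG rmorphM hornerM e1 e2 mulrACA !mulrBr -!exprMn.
  by rewrite !mulr1 mulrBr mulrN1 [x * z]mulrC mulfVK.
have p0 : (map_poly io p).[z] != 0.
  by apply: contraNneq f0 => p0; rewrite ep p0 mulr0.
have G0 : (map_poly io G).[z] != 0.
  by apply: contraNneq H0 => G0; rewrite eH G0 !mulr0.
rewrite ep valM // v_exp //.
case: (coprime_valuation iz cG p0 G0) => [->|vG].
  by exists (v x *+ N./2); rewrite addr0.
have xn0 := expf_neq0 n x0.
exists (v x *+ N./2 + i - v (x ^+ n)).
move: vH; rewrite eH !(valM valv) ?mulf_neq0 // vG.
exact: double_arith.
Qed.

End EvenForms.

Lemma fraction_quotient (A : idomainType) (z : {fraction A}) :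
  exists a b : A, b != 0 /\ z = FracField.tofrac a / FracField.tofrac b.
Proof.
pose x := repr z; exists \n_x, \d_x; split; first exact: denom_ratioP.
have d0 : FracField.tofrac \d_x != 0 by rewrite tofrac_eq0 denom_ratioP.
apply: (mulIf d0); rewrite mulfVK // -[z]reprK -/x; unlock FracField.tofrac.
rewrite -[LHS]FracField.pi_mul; apply/eqmodP.
rewrite /= FracField.equivfE /FracField.mulf.
by rewrite !numden_Ratio ?mulr1 ?oner_eq0 ?denom_ratioP // mulrC.
Qed.

(** * Inequivalent even forms *)

Section RootOrder.
Variables (A : idomainType) (a : A).
Hypothesis ufdA : factorial_ring A.
Implicit Types q : {poly A}.

Lemma rdvd_XsubC q : rdvd ('X - a%:P) q <-> q.[a] = 0.
Proof.
split=> [[c ->]|/eqP/factor_theorem[c ->]].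
  by rewrite hornerM hornerXsubC subrr mul0r.
by exists c; rewrite mulrC.
Qed.

Lemma prime_XsubC : prime_elt ('X - a%:P).
Proof.
split; first by rewrite polyXsubC_eq0.
  by rewrite poly_unitE size_XsubC.
move=> p q; rewrite !rdvd_XsubC hornerM => /eqP; rewrite mulf_eq0.
by case/orP=> /eqP; [left|right].
Qed.

Definition root_order := order (@FracField.tofrac {poly A}) ('X - a%:P).

Let tofrac_inj : injective (@FracField.tofrac {poly A}).
Proof. by move=> x y /eqP; rewrite tofrac_eq => /eqP. Qed.

Let ufdX := factorial_poly ufdA.
Let orderE' := orderE ufdX tofrac_inj (@fraction_quotient _) prime_XsubC.

Lemma root_order_valuation : valuation root_order.
Proof. exact: (order_valuation ufdX tofrac_inj (@fraction_quotient _) prime_XsubC). Qed.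

Lemma root_order0 q : q.[a] != 0 -> root_order (FracField.tofrac q) = 0.
Proof.
move=> qa; apply: orderE'; exists q, 1; split.
- by rewrite rdvd_XsubC; apply/eqP.
- exact: prime_ndvd_unit prime_XsubC (unitr1 _).
- by rewrite expr0z mul1r rmorph1 divr1.
Qed.

Lemma root_order1 q : q.[a] = 0 -> q^`().[a] != 0 ->
  root_order (FracField.tofrac q) = 1.
Proof.
move=> /rdvd_XsubC[c ->]; rewrite derivM derivXsubC mul1r hornerD hornerM.
rewrite hornerXsubC subrr mul0r addr0 => ca; apply: orderE'; exists c, 1; split.
- by rewrite rdvd_XsubC; apply/eqP.
- exact: prime_ndvd_unit prime_XsubC (unitr1 _).
- by rewrite expr1z rmorph1 divr1 rmorphM.
Qed.

End RootOrder.

Section Forms.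
Variables (C : numClosedFieldType) (k : nat).
Notation A := {poly {poly C}}.
Notation X := ('X%:P : A).
Notation Y := ('X : A).
Notation n := (2 ^ k.+1)%N.
Notation i := (@FracField.tofrac A).

(** The element h above, for the exponent n = 2 ^ k.+1: it is the branch divisor of
    the double cover T ^ 2 = h of the plane. *)
Definition disc : A := (Y ^+ n - X ^+ n) * ((- X - Y) ^+ n - X ^+ n).
Definition form (m : nat) : A := Y ^+ (2 ^ m.+1) + X ^+ (2 ^ m.+1).
Definition form_prod (J : {ffun 'I_k -> bool}) : A :=
  \prod_(m < k) form m ^+ J m.

Let ufdC : factorial_ring {poly C} := factorial_poly (@factorial_field C).

Let XN0 N (c : C) : c != 0 -> c%:P * 'X ^+ N != 0 :> {poly C}.
Proof. by move=> c0; rewrite mulf_neq0 ?polyC_eq0 ?expf_neq0 ?polyX_eq0. Qed.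

Lemma form_horner m (c : C) :
  (form m).[c%:P * 'X] = (c ^+ (2 ^ m.+1) + 1)%:P * 'X ^+ (2 ^ m.+1).
Proof.
rewrite /form hornerD !(hornerXn, horner_exp) hornerC exprMn -polyC_exp.
by rewrite polyCD mulrDl mul1r.
Qed.

Lemma form_deriv m (c : C) : c != 0 -> (form m)^`().[c%:P * 'X] != 0.
Proof.
move=> c0; rewrite /form derivD -polyC_exp derivC addr0 derivXn hornerMn hornerXn.
rewrite -mulr_natl exprMn mulf_neq0 //.
  by rewrite -polyC_natr polyC_eq0 pnatr_eq0 -lt0n expn_gt0.
by rewrite -polyC_exp XN0 // expf_neq0.
Qed.

Lemma unity_pow_inj (c : C) i j : c ^+ (2 ^ i) = -1 -> c ^+ (2 ^ j) = -1 -> i = j.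
Proof.
wlog lt_ij : i j / (i < j)%N => [hw ci cj|].
  by case: (ltngtP i j) => // lt; [exact: hw lt ci cj | symmetry; exact: hw lt cj ci].
move=> ci; rewrite -(subnKC lt_ij) addSn -addnS expnD exprM ci expnS exprM sqrrN.
by rewrite !expr1n => /eqP; rewrite -subr_eq0 opprK -(natrD _ 1 1) pnatr_eq0.
Qed.

Lemma form_neq0 m : form m != 0.
Proof.
apply/eqP => e; have := form_horner m 1; rewrite e horner0 => /esym/eqP.
by apply/negP; rewrite XN0 // expr1n -(natrD _ 1 1) pnatr_eq0.
Qed.

Lemma disc_horner1 : disc.['X] = 0.
Proof.
by rewrite /disc hornerM hornerD hornerN hornerXn -polyC_exp hornerC subrr mul0r.
Qed.

Lemma disc_deriv1 : disc^`().['X] != 0.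
Proof.
rewrite /disc derivM hornerD !hornerM.
rewrite [in X in _ + X]hornerD hornerN hornerXn -polyC_exp hornerC subrr mul0r addr0.
rewrite derivB derivC subr0 derivXn hornerMn hornerXn.
rewrite hornerD hornerN hornerC horner_exp hornerD !hornerN hornerC hornerX.
have -> : (- 'X - 'X : {poly C}) = (-2)%:P * 'X by rewrite rmorphN rmorph_nat /=; ring.
rewrite exprMn -polyC_exp -mulr_natl mulf_neq0 //.
  by rewrite -polyC_natr -['X ^+ _]mul1r -polyC1 mulrA -polyCM mulr1 XN0 // pnatr_eq0 -lt0n expn_gt0.
have -> : ((-2) ^+ n)%:P * 'X ^+ n - 'X ^+ n = ((-2) ^+ n - 1)%:P * 'X ^+ n :> {poly C}.
  by rewrite polyCB mulrBl mul1r.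
rewrite XN0 // expnS exprM sqrrN subr_eq0 -exprM -expnS -natrX.
by rewrite -[1]/(1%:R) eqr_nat gtn_eqF // -[1%N](expn0 2) ltn_exp2l // expn_gt0.
Qed.

Lemma disc_neq0 : disc != 0.
Proof. by apply: contraNneq disc_deriv1 => ->; rewrite deriv0 horner0. Qed.

Lemma form_dvd_disc m : (m < k)%N -> rdvd (form m) disc.
Proof.
move=> lt_mk; apply: rdvd_mulr.
have -> : n = ((2 ^ m.+1) * 2 * 2 ^ (k - m.+1))%N.
  by rewrite -expnSr -expnD addSn subnKC.
rewrite !exprM subrXX; apply: rdvd_mulr; rewrite subr_sqr.
by apply: rdvd_mull; exact: rdvd_refl.
Qed.

(** No product of a class of forms is a square, or a square times disc, in the
    fraction field: the first is seen at a root of a form that occurs an odd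
    number of times, the second at the root Y = X of disc. *)
Lemma form_prod_not_square (J L : {ffun 'I_k -> bool}) (d : bool) (a b : A) :
  a != 0 -> b != 0 ->
  form_prod J * form_prod L * b ^+ 2 = disc ^+ d * a ^+ 2 -> J = L.
Proof.
move=> a0 b0 e; apply/ffunP => m; apply/eqP; apply: contraT => neJL; exfalso.
have prod0 I : form_prod I != 0.
  by apply/prodf_neq0 => i _; rewrite expf_neq0 ?form_neq0.
have i0 q : (i q == 0) = (q == 0) := tofrac_eq0 q.
have {}e : i (form_prod J) * i (form_prod L) * i b ^+ 2 = i disc ^+ d * i a ^+ 2.
  by rewrite -!rmorphXn -!rmorphM e.
have main (c : {poly C}) :
    root_order c (i (form_prod J)) + root_order c (i (form_prod L)) + root_order c (i b) *+ 2 =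
    root_order c (i disc) *+ d + root_order c (i a) *+ 2.
  have valv : valuation (root_order c) := root_order_valuation c ufdC.
  have := congr1 (root_order c) e.
  by rewrite !(valM valv) ?(valX valv) ?mulf_neq0 ?expf_neq0 ?i0 ?disc_neq0.
have v_prod (c : {poly C}) I :
    root_order c (i (form_prod I)) = \sum_(j < k) root_order c (i (form j)) *+ I j.
  have valv : valuation (root_order c) := root_order_valuation c ufdC.
  rewrite /form_prod rmorph_prod (val_prod valv) => [|j]; last first.
    by rewrite rmorphXn expf_neq0 // i0 form_neq0.
  by apply: eq_bigr => j _; rewrite rmorphXn (valX valv) // i0 form_neq0.
have vform0 (c : C) j : c != 0 ->
    c ^+ (2 ^ j.+1) + 1 != 0 -> root_order (c%:P * 'X) (i (form j)) = 0.
  by move=> c0 cj; apply: (root_order0 ufdC); rewrite form_horner XN0.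
have d0 : d = false.
  pose w : {poly C} := 1%:P * 'X.
  have vp I : root_order w (i (form_prod I)) = 0.
    rewrite v_prod big1 // => j _; rewrite /w vform0 ?mul0rn ?oner_eq0 //.
    by rewrite expr1n -(natrD _ 1 1) pnatr_eq0.
  have vd : root_order w (i disc) = 1.
    apply: (root_order1 ufdC); rewrite /w mul1r; [exact: disc_horner1|].
    exact: disc_deriv1.
  have := main w; rewrite !vp vd.
  by move: (root_order w (i a)) (root_order w (i b)) => r1 r2; case: (d) => //; lia.
pose c : C := (2 ^ m.+1).-root (-1).
have cm : c ^+ (2 ^ m.+1) = -1 by rewrite rootCK // expn_gt0.
have c0 : c != 0 by rewrite rootC_eq0 ?expn_gt0 // oppr_eq0 oner_eq0.
pose w : {poly C} := c%:P * 'X.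
have vp I : root_order w (i (form_prod I)) = (I m)%:R.
  rewrite v_prod (bigD1 m) //= big1 => [|j jm].
    rewrite addr0 (root_order1 ufdC) //; last exact: form_deriv.
    by rewrite form_horner cm addNr mul0r.
  rewrite /w vform0 ?mul0rn // addr_eq0; apply: contraNneq jm => cj.
  by apply/eqP/val_inj; have [] := unity_pow_inj cj cm.
have := main w; rewrite !vp d0.
move: (root_order w (i disc)) (root_order w (i a)) (root_order w (i b)) => r0 r1 r2.
by move: neJL; case: (J m); case: (L m) => // _ h; lia.
Qed.

End Forms.

Lemma even_eltM (F : fieldType) (s : F -> F) e1 e2 : e1 != 0 -> e2 != 0 ->
  even_elt s e1 -> even_elt s e2 -> even_elt s (e1 * e2).
Proof.
move=> e10 e20 ev1 ev2 v valv sv.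
have [i ei] := ev1 v valv sv; have [j ej] := ev2 v valv sv.
by exists (i + j); rewrite valM // ei ej addrACA.
Qed.

Section LowerBound.
Variables (C : numClosedFieldType) (k : nat).
Notation A := {poly {poly C}}.
Variables (F : fieldType) (io : {rmorphism {poly A} -> F}) (s : {rmorphism F -> F}).
Hypotheses (io_inj : injective io).
Hypothesis io_frac : forall z, exists a b, b != 0 /\ z = io a / io b.
Hypotheses (sK : involutive s) (sA : forall a : A, s (io a%:P) = io a%:P).
Hypothesis sT : io 'X * s (io 'X) = io (disc C k)%:P.

Notation i := (fun a : A => io a%:P).

Let ufdA : factorial_ring A := factorial_poly (factorial_poly (@factorial_field C)).

Let i0 (a : A) : (io a%:P == 0) = (a == 0).
Proof. by rewrite -(rmorph0 io) (inj_eq io_inj) polyC_eq0. Qed.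

(** The valuation of disc is even, because disc is the norm of T. *)
Lemma even_form_elt m : (m < k)%N -> even_elt s (io (form C m)%:P).
Proof.
move=> lt_mk v valv sv.
pose x := io ('X%:P : A)%:P; pose y := io ('X : A)%:P.
have ef N : y ^+ N + x ^+ N = io ('X ^+ N + 'X%:P ^+ N : A)%:P.
  by rewrite polyCD !polyC_exp rmorphD !rmorphXn.
have eg N : y ^+ N - x ^+ N = io ('X ^+ N - 'X%:P ^+ N : A)%:P.
  by rewrite polyCB !polyC_exp rmorphB !rmorphXn.
have eg' N : (- x - y) ^+ N - x ^+ N = io ((- 'X%:P - 'X) ^+ N - 'X%:P ^+ N : A)%:P.
  by rewrite polyCB !polyC_exp polyCB polyCN rmorphB !rmorphXn rmorphB rmorphN.
have eH : (y ^+ (2 ^ k.+1) - x ^+ (2 ^ k.+1)) *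
    ((- x - y) ^+ (2 ^ k.+1) - x ^+ (2 ^ k.+1)) = io (disc C k)%:P.
  by rewrite eg eg' -rmorphM -polyCM.
have T0 : io 'X != 0 by rewrite -(rmorph0 io) (inj_eq io_inj) polyX_eq0.
rewrite /form -ef.
apply: (@even_form _ _ [the {rmorphism C -> F} of io \o polyC \o polyC \o polyC]
  v valv x y _ (2 ^ k.+1) (v (io 'X))).
- by rewrite i0 polyC_eq0 polyX_eq0.
- by rewrite i0 polyX_eq0.
- by rewrite ef i0 (form_neq0 C m).
- by rewrite expn_gt0.
- by rewrite expn_gt0.
- by rewrite coprimeXr.
- by rewrite oddX.
- by rewrite -expnSr dvdn_exp2l.
- by rewrite eH i0 disc_neq0.
- by rewrite eH -sT valM ?fmorph_eq0 // sv.
Qed.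

Theorem many_classes_disc : many_classes s #|{ffun 'I_k -> bool}|.
Proof.
have f0 (J : {ffun 'I_k -> bool}) : io (form_prod C J)%:P != 0.
  by rewrite i0; apply/prodf_neq0 => j _; rewrite expf_neq0 ?form_neq0.
have ufm m : (m < k)%N -> sunit io (disc C k) (io (form C m)%:P).
  by move=> lt_mk; apply: (@sunit_dvd_h _ _ _ _ _ 1); rewrite expr1; exact: form_dvd_disc.
have ufp (J : {ffun 'I_k -> bool}) : sunit io (disc C k) (io (form_prod C J)%:P).
  rewrite /form_prod; elim/big_rec: _ => [|j a _ IH].
    by rewrite polyC1 rmorph1; exact: sunit1.
  rewrite polyCM polyC_exp rmorphM rmorphXn; apply: (sunitM io_inj) IH.
  by apply: (sunitX io_inj); apply: ufm.
exists (fun j => io (form_prod C (enum_val j))%:P); split=> [j|j l f e].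
  split=> //; move: (enum_val j) => J; rewrite /form_prod.
  suff [] : io (\prod_(m < k) form C m ^+ J m)%:P != 0 /\
    even_elt s (io (\prod_(m < k) form C m ^+ J m)%:P) by [].
  have ev1 : even_elt s (io (1 : A)%:P).
    by move=> v valv _; exists 0; rewrite !rmorph1 val1.
  elim/big_rec: _ => [|m a _ [a0 IH]]; first by rewrite i0 oner_eq0.
  have fm0 : io (form C m)%:P != 0 by rewrite i0 form_neq0.
  rewrite polyCM rmorphM; case: (J m); rewrite ?expr0 ?expr1.
    split; first by rewrite mulf_neq0.
    by apply: even_eltM => //; apply: even_form_elt.
  by rewrite polyC1 rmorph1 mul1r.
have D0 := disc_neq0 C k.
set J := enum_val j in e; set L := enum_val l in e.
suff : J = L by move/enum_val_inj.
pose g := f * io (form_prod C L)%:P.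
have eg : g * s g = io (form_prod C J * form_prod C L)%:P.
  by rewrite /g rmorphM sA polyCM rmorphM e mulrACA mulrA.
have g0 : g != 0.
  by apply: contraNneq (f0 J) => g0; rewrite e mulrAC -/g g0 mul0r.
have [|u uu eu] := sunit_norm ufdA io_inj io_frac sK sA D0 sT g0.
  by rewrite eg polyCM rmorphM; apply: (sunitM io_inj).
have [d [a [b [a0 b0 en]]]] := norm_of_sunit io_inj sA D0 sT uu.
apply: (form_prod_not_square a0 b0 (d := d)).
have /io_inj/polyC_inj : io (form_prod C J * form_prod C L * b ^+ 2)%:P =
    io (disc C k ^+ d * a ^+ 2)%:P.
  by rewrite polyCM rmorphM -eg eu en.
by [].
Qed.

End LowerBound.

(** * Birational maps as automorphisms of the function field *)

(** Locked, because unification would otherwise unfold polynomials when it compares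
    two evaluations. *)
HB.lock Definition eval (K : fieldType) (n : nat) (F : comNzRingType)
  (io : {rmorphism K -> F}) (w : 'I_n -> F) (p : {mpoly K[n]}) : F := mmap io w p.

Section Evaluation.
Variables (K : fieldType) (n : nat) (F : comNzRingType).
Variable io : {rmorphism K -> F}.
Notation pol := {mpoly K[n]}.
Implicit Types (w : 'I_n -> F) (p : pol).

Let eval_zmod w : zmod_morphism (eval io w).
Proof. by rewrite unlock; exact: rmorphB. Qed.

Let eval_monoid w : monoid_morphism (eval io w).
Proof. by rewrite unlock; split; [exact: rmorph1 | exact: rmorphM]. Qed.

HB.instance Definition _ w := GRing.isZmodMorphism.Build pol F (eval io w) (eval_zmod w).
HB.instance Definition _ w :=
  GRing.isMonoidMorphism.Build pol F (eval io w) (eval_monoid w).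

Lemma evalX w i : eval io w 'X_i = w i.
Proof. by rewrite unlock mmapX mmap1U. Qed.

Lemma evalC w c : eval io w c%:MP = io c.
Proof. by rewrite unlock mmapC. Qed.

Lemma eval_sum w p :
  eval io w p = \sum_(m <- msupp p) io p@_m * \prod_(i < n) w i ^+ m i.
Proof. by rewrite unlock. Qed.

Lemma eval_homogZ d p w w' c : p \is d.-homog ->
  (forall i, w' i = c * w i) -> eval io w' p = c ^+ d * eval io w p.
Proof.
move=> /dhomogP hp hw; rewrite !eval_sum mulr_sumr big_seq [RHS]big_seq.
apply: eq_bigr => m /hp; rewrite /= mdegE => <-.
rewrite mulrCA; congr (_ * _); rewrite -prodrXr -big_split.
by apply: eq_bigr => i _; rewrite hw exprMn.
Qed.

End Evaluation.

Lemma eval_comp (K : fieldType) n m (F : comNzRingType) (io : {rmorphism K -> F})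
    (w : 'I_m -> F) (p : {mpoly K[n]}) (g : n.-tuple {mpoly K[m]}) :
  eval io w (p \mPo g) = eval io (fun i => eval io w (tnth g i)) p.
Proof.
rewrite comp_mpolyE rmorph_sum /= eval_sum; apply: eq_bigr => q _.
rewrite -mul_mpolyC rmorphM /= evalC; congr (_ * _).
by rewrite rmorph_prod; apply: eq_bigr => i _; rewrite rmorphXn.
Qed.

Section Quotients.
Variables (R : comNzRingType) (F : fieldType) (e : {rmorphism R -> F}).
Implicit Types p q : R.

Lemma quotientB p q p' q' : e q != 0 -> e q' != 0 ->
  e p / e q - e p' / e q' = e (p * q' - p' * q) / e (q * q').
Proof.
move=> q0 q'0; rewrite rmorphB !rmorphM /=.
by move: (e p) (e q) (e p') (e q') q0 q'0 => a b c d b0 d0; field; rewrite b0 d0.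
Qed.

Lemma quotientM p q p' q' :
  e p / e q * (e p' / e q') = e (p * p') / e (q * q').
Proof. by rewrite !rmorphM mulf_div. Qed.

Lemma quotient_eq p q p' q' : e q != 0 -> e q' != 0 ->
  p * q' = p' * q -> e p / e q = e p' / e q'.
Proof. by move=> q0 q'0 h; apply/eqP; rewrite eqr_div // -!rmorphM h. Qed.

End Quotients.

(** A field F with generic homogeneous coordinates, normalized to have first
    coordinate 1: homogeneous polynomials do not vanish at them, and F consists of
    the values of the rational functions on P^n. *)
Record coordinates (K : fieldType) (n : nat) (F : fieldType) := Coordinates {
  cst : {rmorphism K -> F};
  coord : 'I_n.+1 -> F;
  coord0 : coord ord0 = 1;
  coord_inj : forall d (p : {mpoly K[n.+1]}), p \is d.-homog ->
    eval cst coord p = 0 -> p = 0;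
  coord_frac : forall z : F, exists d (p q : {mpoly K[n.+1]}),
    [/\ p \is d.-homog, q \is d.-homog, q != 0
      & z = eval cst coord p / eval cst coord q] }.

Section Action.
Variables (K : fieldType) (n : nat) (F : fieldType) (G : coordinates K n F).
Notation pol := {mpoly K[n.+1]}.
Notation tup := (n.+1.-tuple pol).
Notation v := (coord G).
Notation ev := (eval (cst G) (coord G)).
Notation evat w := (eval (cst G) w).
Implicit Types (f g : tup) (p q : pol).

(** The image of the generic point, in homogeneous coordinates. *)
Definition at_generic f (i : 'I_n.+1) : F := ev (tnth f i).

Lemma ev_comp p f : ev (p \mPo f) = evat (at_generic f) p.
Proof. exact: eval_comp. Qed.

Lemma ev_eq0 d p : p \is d.-homog -> (ev p == 0) = (p == 0).
Proof.
move=> hp; apply/eqP/eqP => [|->]; last by rewrite rmorph0.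
exact: coord_inj hp.
Qed.

Lemma homogX i : ('X_i : pol) \is 1.-homog.
Proof. by rewrite dhomogX /= mdeg1. Qed.

Lemma cross_homog d e p q p' q' : p \is d.-homog -> q \is d.-homog ->
    p' \is e.-homog -> q' \is e.-homog ->
  ev p * ev q' = ev q * ev p' -> p * q' = q * p'.
Proof.
move=> hp hq hp' hq' h; apply/eqP; rewrite -subr_eq0 -(@ev_eq0 (d + e)).
  by rewrite rmorphB !rmorphM /= h subrr.
by apply: rpredB; apply: dhomogM.
Qed.

(** Proportionality can be tested at the generic point. *)
Lemma proj_eq_ev f g : ratmap f -> ratmap g ->
  (forall i j, at_generic f i * at_generic g j = at_generic f j * at_generic g i) ->
  proj_eq f g.
Proof.
move=> [[d hf] nf] [[e hg] ng] h; apply: cross_proj_eq => // i j.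
by apply: cross_homog (hf i) (hf j) (hg i) (hg j) _; apply: h.
Qed.

(** For a map and its inverse to be mutually inverse, it is enough that they are so
    at the generic point. *)
Lemma birational_ev f g d e :
    (forall i, tnth f i \is d.-homog) -> (forall i, tnth g i \is e.-homog) ->
    (exists2 c, c != 0 & forall i, evat (at_generic g) (tnth f i) = c * v i) ->
    (exists2 c, c != 0 & forall i, evat (at_generic f) (tnth g i) = c * v i) ->
  birational f.
Proof.
have half f1 g1 d1 e1 : (forall i, tnth f1 i \is d1.-homog) ->
    (forall i, tnth g1 i \is e1.-homog) ->
    (exists2 c, c != 0 & forall i, evat (at_generic g1) (tnth f1 i) = c * v i) ->
    ratmap f1 /\ proj_eq (tup_comp f1 g1) (tup_id K n).
  move=> hf hg [c c0 e0]; have ec i : at_generic (tup_comp f1 g1) i = c * v i.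
    by rewrite /at_generic tnth_mktuple ev_comp e0.
  have nf : tnth (tup_comp f1 g1) ord0 != 0.
    apply: contraNneq c0 => n0; have := ec ord0.
    by rewrite /at_generic n0 rmorph0 coord0 mulr1 => <-.
  split.
    split; first by exists d1.
    exists ord0; apply: contraNneq nf => n0.
    by rewrite tnth_mktuple n0 comp_mpoly0.
  apply: proj_eq_ev; last 2 first.
  - exact: ratmap_id.
  - move=> i j; rewrite !ec /at_generic !tnth_mktuple !evalX.
    by rewrite mulrAC.
  split; last by exists ord0.
  by exists (e1 * d1)%N => i; rewrite tnth_mktuple comp_homog.
move=> hf hg fg gf; have [rf pf] := half _ _ _ _ hf hg fg.
by have [rg pg] := half _ _ _ _ hg hf gf; split=> //; exists g.
Qed.

(** If q vanished on the image of f, it would vanish on the image of f o g, which is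
    the identity. *)
Lemma comp_neq0 f d q : birational f -> q \is d.-homog -> q != 0 -> q \mPo f != 0.
Proof.
case=> _ [g [_ [a [b [a0 b0 e]]] _]] hq; apply: contraNneq => q0.
pose h := [tuple a * tnth (tup_comp f g) i | i < n.+1].
have e1 : q \mPo h = 0.
  rewrite (@comp_homogZ _ _ d q a (tup_comp f g)) //.
    by rewrite comp_mpolyA q0 comp_mpoly0 mulr0.
  by move=> i; rewrite tnth_mktuple.
have : q \mPo h = b ^+ d * q.
  rewrite (@comp_homogZ _ _ d q b (tup_id K n)) ?comp_mpoly_id //.
  by move=> i; rewrite tnth_mktuple e.
rewrite e1 => /esym/eqP; rewrite mulf_eq0 => /orP[bd0|//].
by rewrite (negbTE (expf_neq0 d b0)) in bd0.
Qed.

Lemma evat_neq0 f d q : birational f -> q \is d.-homog -> q != 0 ->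
  evat (at_generic f) q != 0.
Proof.
move=> bf hq q0; have [[[e hf] _] _] := bf.
by rewrite -ev_comp (ev_eq0 (comp_homog hq hf)) (comp_neq0 bf hq).
Qed.

Lemma at_generic0 f : birational f -> at_generic f ord0 != 0.
Proof.
move=> bf; rewrite -(evalX (cst G) (at_generic f)).
apply: (evat_neq0 bf (homogX ord0)).
by rewrite -(ev_eq0 (homogX ord0)) evalX coord0 oner_eq0.
Qed.

(** Composition with f, on rational functions written as quotients of forms of the
    same degree. *)
Definition is_pullback f (z z' : F) := exists d p q,
  [/\ p \is d.-homog, q \is d.-homog, q != 0, z = ev p / ev q
    & z' = evat (at_generic f) p / evat (at_generic f) q].

Lemma pullback_ex f z : exists z', is_pullback f z z'.
Proof.
have [d [p [q [hp hq q0 e]]]] := coord_frac G z.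
by exists (evat (at_generic f) p / evat (at_generic f) q), d, p, q.
Qed.

Definition pullback f z : F := projT1 (cid (pullback_ex f z)).

Lemma pullbackE f d p q : birational f -> p \is d.-homog -> q \is d.-homog ->
  q != 0 ->
  pullback f (ev p / ev q) = evat (at_generic f) p / evat (at_generic f) q.
Proof.
move=> bf hp hq q0; rewrite /pullback; case: cid => z' [d' [p' [q' []]]] /=.
move=> hp' hq' q'0 e ->.
have Q0 : ev q != 0 by rewrite (ev_eq0 hq).
have Q'0 : ev q' != 0 by rewrite (ev_eq0 hq').
apply: quotient_eq; [exact: evat_neq0 hq' q'0 | exact: evat_neq0 hq q0 |].
rewrite [RHS]mulrC; apply: cross_homog hp' hq' hp hq _.
by apply/eqP; rewrite [X in _ == X]mulrC -eqr_div // -e.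
Qed.

Lemma pullback_proj_eq f f' z : birational f -> birational f' -> proj_eq f f' ->
  pullback f z = pullback f' z.
Proof.
move=> bf bf' ff'; have [d [p [q [hp hq q0 ->]]]] := coord_frac G z.
rewrite (pullbackE bf hp hq q0) (pullbackE bf' hp hq q0).
have f0 := at_generic0 bf; have f'0 := at_generic0 bf'.
pose c := at_generic f ord0 / at_generic f' ord0.
have c0 : c != 0 by rewrite mulf_neq0 ?invr_eq0.
have ec i : at_generic f i = c * at_generic f' i.
  rewrite /c mulrAC; apply: (canRL (mulfK f'0)).
  by rewrite -!rmorphM (proj_eq_cross ff' i ord0).
rewrite (eval_homogZ _ hp ec) (eval_homogZ _ hq ec).
by rewrite -mulf_div divff ?expf_neq0 // mul1r.
Qed.

Lemma pullback_zmod f : birational f -> zmod_morphism (pullback f).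
Proof.
move=> bf x y; have [d [p [q [hp hq q0 ->]]]] := coord_frac G x.
have [d' [p' [q' [hp' hq' q'0 ->]]]] := coord_frac G y.
rewrite (pullbackE bf hp hq q0) (pullbackE bf hp' hq' q'0).
rewrite !quotientB ?(evat_neq0 bf hq q0) ?(evat_neq0 bf hq' q'0) //; last first.
- by rewrite (ev_eq0 hq').
- by rewrite (ev_eq0 hq).
apply: (@pullbackE f (d + d')) => //; last 1 first.
- by rewrite mulf_neq0.
- by apply: rpredB; [|rewrite addnC]; apply: dhomogM.
- exact: dhomogM.
Qed.

Lemma pullback_monoid f : birational f -> monoid_morphism (pullback f).
Proof.
move=> bf; split.
  have e1 : ev 1 / ev 1 = 1 by rewrite rmorph1 divr1.
  rewrite -[in LHS]e1 (@pullbackE f 0) ?oner_eq0 ?dhomog1 //.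
  by rewrite !rmorph1 divr1.
move=> x y; have [d [p [q [hp hq q0 ->]]]] := coord_frac G x.
have [d' [p' [q' [hp' hq' q'0 ->]]]] := coord_frac G y.
rewrite (pullbackE bf hp hq q0) (pullbackE bf hp' hq' q'0) !quotientM.
apply: (@pullbackE f (d + d')) => //; last 1 first.
- by rewrite mulf_neq0.
- exact: dhomogM.
- exact: dhomogM.
Qed.

Lemma pullback_comp f g z : birational f -> birational g ->
  pullback (tup_comp f g) z = pullback g (pullback f z).
Proof.
move=> bf bg; have [d [p [q [hp hq q0 ->]]]] := coord_frac G z.
have [[[e hf] _] _] := bf.
rewrite (pullbackE (birational_comp bf bg) hp hq q0) (pullbackE bf hp hq q0).
rewrite -!ev_comp (pullbackE bg (comp_homog hp hf) (comp_homog hq hf)).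
  by rewrite -!ev_comp !comp_mpolyA.
exact: comp_neq0 bf hq q0.
Qed.

Lemma pullback_id z : pullback (tup_id K n) z = z.
Proof.
have [d [p [q [hp hq q0 ->]]]] := coord_frac G z.
by rewrite (pullbackE (birational_id K n) hp hq q0) -!ev_comp !comp_mpoly_id.
Qed.

Lemma pullback_cst f c : birational f -> pullback f (cst G c) = cst G c.
Proof.
move=> bf; have e1 : cst G c = ev c%:MP / ev 1 by rewrite rmorph1 divr1 evalC.
rewrite {1}e1 (@pullbackE f 0) ?oner_eq0 ?dhomog1 //.
  by rewrite rmorph1 divr1 evalC.
by rewrite -alg_mpolyC dhomogZ ?dhomog1.
Qed.

Lemma pullback_coord f i : birational f ->
  pullback f (v i) = at_generic f i / at_generic f ord0.
Proof.
move=> bf; have -> : v i = ev 'X_i / ev 'X_ord0.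
  by rewrite !evalX coord0 divr1.
rewrite (@pullbackE f 1) ?homogX // ?evalX //.
by rewrite -(ev_eq0 (homogX ord0)) evalX coord0 oner_eq0.
Qed.

End Action.

HB.lock Definition act (K : fieldType) (n : nat) (F : fieldType)
  (G : coordinates K n F) (x : Bir K n) : F -> F := pullback G (repr x).

Section GroupAction.
Variables (K : fieldType) (n : nat) (F : fieldType) (G : coordinates K n F).
Notation v := (coord G).

Lemma actE (f : birat K n) z : act G (\pi_(Bir K n) f) z = pullback G f z.
Proof.
by rewrite unlock; apply: pullback_proj_eq; [exact: biratP.. | exact: proj_eq_repr].
Qed.

Let act_zmod x : zmod_morphism (act G x).
Proof. by rewrite unlock; exact/pullback_zmod/biratP. Qed.

Let act_monoid x : monoid_morphism (act G x).
Proof. by rewrite unlock; exact/pullback_monoid/biratP. Qed.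

HB.instance Definition _ x := GRing.isZmodMorphism.Build F F (act G x) (act_zmod x).
HB.instance Definition _ x :=
  GRing.isMonoidMorphism.Build F F (act G x) (act_monoid x).

Lemma act_cst x c : act G x (cst G c) = cst G c.
Proof. by rewrite unlock; exact/pullback_cst/biratP. Qed.

(** Pullback reverses the order of composition. *)
Lemma act_mul x y z : act G (x * y)%g z = act G y (act G x z).
Proof.
rewrite -[x]reprK -[y]reprK [(_ * _)%g]Bir_mulE !actE /=.
by apply: pullback_comp; exact: biratP.
Qed.

Lemma act_one z : act G 1%g z = z.
Proof. by rewrite [1%g]/(Bir_one K n) actE pullback_id. Qed.

Lemma actK x : cancel (act G x) (act G x^-1%g).
Proof. by move=> z; rewrite -act_mul mulgV act_one. Qed.

(** A birational map is determined by its action on the coordinates. *)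
Lemma act_coord_inj x y : (forall i, act G x (v i) = act G y (v i)) -> x = y.
Proof.
move=> h; rewrite -[x]reprK -[y]reprK; apply/Bir_eqP.
have bx := biratP (repr x); have by_ := biratP (repr y).
have x0 := at_generic0 G bx; have y0 := at_generic0 G by_.
apply: (proj_eq_ev (G := G)); [exact: bx.1 | exact: by_.1 | move=> i j].
have hh l : at_generic G (repr x) l = at_generic G (repr y) l /
    at_generic G (repr y) ord0 * at_generic G (repr x) ord0.
  by have := h l; rewrite unlock !pullback_coord // => <-; rewrite mulfVK.
rewrite (hh i) (hh j).
move: (at_generic G (repr y)) (at_generic G (repr x) ord0) y0 => w t y0.
by field.
Qed.

End GroupAction.

(** * Coordinates on affine space *)

Lemma prod_ord4 (R : comNzRingType) (f : 'I_4 -> R) : f ord0 = 1 ->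
  \prod_i f i = f (inord 1) * f (inord 2) * f (inord 3).
Proof.
move=> f0; rewrite !big_ord_recl big_ord0 mulr1 f0 mul1r mulrA.
by congr (f _ * f _ * f _); apply/val_inj; rewrite /= inordK.
Qed.

Section AffineSpace.
Variable C : fieldType.
Notation A0 := {poly {poly {poly C}}}.
Notation F := {fraction A0}.

Definition affine_cst : C -> A0 := polyC \o polyC \o polyC.
HB.instance Definition _ := GRing.RMorphism.on affine_cst.

Definition affine_coord (i : 'I_4) : A0 := [:: 1; 'X%:P%:P; 'X%:P; 'X]`_i.

Notation ev0 := (eval affine_cst affine_coord).

Lemma affine_coordE : [/\ affine_coord ord0 = 1,
  affine_coord (inord 1) = 'X%:P%:P, affine_coord (inord 2) = 'X%:P
  & affine_coord (inord 3) = 'X].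
Proof. by rewrite /affine_coord !inordK. Qed.

Lemma affine_monomial (m : 'X_{1..4}) : \prod_(i < 4) affine_coord i ^+ m i =
  (('X^(m (inord 1)))%:P * 'X^(m (inord 2)))%:P * 'X^(m (inord 3)).
Proof.
have [c0 c1 c2 c3] := affine_coordE.
rewrite prod_ord4; last by rewrite c0; exact: expr1n.
rewrite c1 c2 c3; congr (_ * _).
by rewrite [RHS]polyCM; congr (_ * _); rewrite !polyC_exp.
Qed.

Lemma coef_triple (c : C) i j l i' j' l' :
  (affine_cst c * ((('X^i)%:P * 'X^j)%:P * 'X^l))`_l'`_j'`_i' =
  c *+ [&& l' == l, j' == j & i' == i].
Proof.
rewrite mulrA coefMXn; case: ltngtP => [_|lt|->]; rewrite ?coef0 //.
  by rewrite -polyCM coefC subn_eq0 leqNgt lt !coef0.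
rewrite subnn -polyCM coefC eqxx mulrA -polyCM coefMXn.
case: (ltngtP j' j) => [_|lt|->]; rewrite ?coef0 //.
  by rewrite coefC subn_eq0 leqNgt lt coef0.
by rewrite subnn coefC eqxx coefCM coefXn mulr_natr.
Qed.

Lemma mdeg4 (m : 'X_{1..4}) :
  mdeg m = (m (inord 0) + m (inord 1) + m (inord 2) + m (inord 3))%N.
Proof.
rewrite mdegE !big_ord_recl big_ord0 addn0 !addnA.
by congr (m _ + m _ + m _ + m _)%N; apply/val_inj; rewrite /= inordK.
Qed.

(** The exponent of the first variable is determined by the degree and the other
    exponents, so that dehomogenization identifies no two monomials. *)
Lemma affine_coord_inj d (p : {mpoly C[4]}) : p \is d.-homog ->
  ev0 p = 0 -> p = 0.
Proof.
move=> /dhomogP hp ev_p0; apply/mpolyP => m; rewrite mcoeff0.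
apply/eqP; apply: contraT => pm0; have := hp m; rewrite mcoeff_msupp => /(_ pm0) md.
have := congr1 (fun P : A0 => P`_(m (inord 3))`_(m (inord 2))`_(m (inord 1))) ev_p0.
rewrite !coef0 eval_sum !coef_sum (bigD1_seq m) ?msupp_uniq ?mcoeff_msupp //.
rewrite affine_monomial coef_triple !eqxx mulr1n.
rewrite big_seq_cond big1 /= ?addr0 => [pm|m' /andP[/hp md' m'm]].
  by rewrite pm eqxx in pm0.
rewrite affine_monomial coef_triple; case: and3P => // -[/eqP e3 /eqP e2 /eqP e1].
case/eqP: m'm; apply/mnmP.
suff e0 : m' (inord 0) = m (inord 0).
  case=> -[|[|[|[|i]]]] // lti.
  - by rewrite (_ : Ordinal lti = inord 0) //; apply/val_inj; rewrite /= inordK.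
  - by rewrite (_ : Ordinal lti = inord 1) //; apply/val_inj; rewrite /= inordK.
  - by rewrite (_ : Ordinal lti = inord 2) //; apply/val_inj; rewrite /= inordK.
  - by rewrite (_ : Ordinal lti = inord 3) //; apply/val_inj; rewrite /= inordK.
move: md md'; rewrite /= !mdeg4 => md md'; lia.
Qed.

Lemma homogXn n (K : fieldType) (i : 'I_n.+1) d :
  ('X_i ^+ d : {mpoly K[n.+1]}) \is d.-homog.
Proof. by have := dhomogMn d (homogX K i); rewrite mul1n. Qed.

Lemma affine_homogenize (B : A0) : exists D, forall d, (D <= d)%N ->
  exists2 p : {mpoly C[4]}, p \is d.-homog & ev0 p = B.
Proof.
pose S (P : A0) := exists D, forall d, (D <= d)%N ->
  exists2 p : {mpoly C[4]}, p \is d.-homog & ev0 p = P.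
have SX i : S (affine_coord i).
  exists 1 => -[|d] // _; exists ('X_ord0 ^+ d * 'X_i).
    by rewrite -(addn1 d); apply: dhomogM; [exact: homogXn | exact: homogX].
  by rewrite rmorphM rmorphXn /= !evalX expr1n mul1r.
have SC (c : C) : S (affine_cst c).
  exists 0 => d _; exists (c *: 'X_ord0 ^+ d).
    by rewrite dhomogZ ?homogXn.
  by rewrite -mul_mpolyC rmorphM rmorphXn /= evalC evalX expr1n mulr1.
have SD P Q : S P -> S Q -> S (P + Q).
  case=> D hD [E hE]; exists (maxn D E) => d; rewrite geq_max => /andP[/hD[p hp <-] /hE[q hq <-]].
  by exists (p + q); rewrite ?rpredD ?rmorphD.
have SM P Q : S P -> S Q -> S (P * Q).
  case=> D hD [E hE]; exists (D + E)%N => d le_d.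
  have [p hp <-] := hD D (leqnn _); have [|q hq <-] := hE (d - D)%N.
    by rewrite leq_subRL // (leq_trans _ le_d) ?leq_addr.
  exists (p * q); last by rewrite rmorphM.
  rewrite -(subnKC (leq_trans (leq_addr E D) le_d)); exact: dhomogM.
have [c0 c1 c2 c3] := affine_coordE.
have S0 : S 0 by rewrite -(rmorph0 affine_cst); exact: SC.
have SX1 : S 'X%:P%:P by rewrite -c1; exact: SX.
have SX2 : S 'X%:P by rewrite -c2; exact: SX.
have SX3 : S 'X by rewrite -c3; exact: SX.
have S2 (a : {poly C}) : S a%:P%:P.
  elim/poly_ind: a => [|a c IH]; first exact: S0.
  by rewrite !polyCD !polyCM; apply: SD (SM _ _ IH SX1) (SC c).
have S1 (a : {poly {poly C}}) : S a%:P.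
  elim/poly_ind: a => [|a c IH]; first exact: S0.
  by rewrite polyCD polyCM; apply: SD (SM _ _ IH SX2) (S2 c).
suff h : S B by exact: h.
by elim/poly_ind: B => [|a c IH]; [exact: S0 | apply: SD (SM _ _ IH SX3) (S1 c)].
Qed.

Definition space_cst : C -> F := @FracField.tofrac A0 \o affine_cst.
HB.instance Definition _ := GRing.RMorphism.on space_cst.

Definition space_coord (i : 'I_4) : F := FracField.tofrac (affine_coord i).

Lemma space_evE (p : {mpoly C[4]}) :
  eval space_cst space_coord p = FracField.tofrac (ev0 p).
Proof.
rewrite !eval_sum rmorph_sum /=; apply: eq_bigr => m _.
rewrite rmorphM /=; congr (_ * _); rewrite rmorph_prod.
by apply: eq_bigr => i _; rewrite rmorphXn.
Qed.

Lemma space_coord0 : space_coord ord0 = 1.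
Proof. exact: rmorph1. Qed.

Lemma space_coord_inj d (p : {mpoly C[4]}) : p \is d.-homog ->
  eval space_cst space_coord p = 0 -> p = 0.
Proof.
move=> hp; rewrite space_evE => /eqP; rewrite tofrac_eq0 => /eqP.
exact: affine_coord_inj hp.
Qed.

Lemma space_coord_frac (z : F) : exists d (p q : {mpoly C[4]}),
  [/\ p \is d.-homog, q \is d.-homog, q != 0
    & z = eval space_cst space_coord p / eval space_cst space_coord q].
Proof.
have [a [b [b0 ->]]] := fraction_quotient z.
have [D hD] := affine_homogenize a; have [E hE] := affine_homogenize b.
have [p hp ep] := hD (D + E)%N (leq_addr _ _).
have [q hq eq] := hE (D + E)%N (leq_addl _ _).
exists (D + E)%N, p, q; split; rewrite ?space_evE ?ep ?eq //.
by apply: contraNneq b0 => q0; rewrite -eq q0 rmorph0.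
Qed.

Definition space_coordinates : coordinates C 3 F :=
  Coordinates space_coord0 space_coord_inj space_coord_frac.

End AffineSpace.

(** * The Klein four-group *)

Lemma ord4P (P : 'I_4 -> Prop) : P ord0 -> P (inord 1) -> P (inord 2) ->
  P (inord 3) -> forall i, P i.
Proof.
move=> P0 P1 P2 P3 [[|[|[|[|i]]]] lti] //.
- by rewrite (_ : Ordinal lti = ord0) //; apply/val_inj.
- by rewrite (_ : Ordinal lti = inord 1) //; apply/val_inj; rewrite /= inordK.
- by rewrite (_ : Ordinal lti = inord 2) //; apply/val_inj; rewrite /= inordK.
- by rewrite (_ : Ordinal lti = inord 3) //; apply/val_inj; rewrite /= inordK.
Qed.

Lemma mem_uniq4 (i j l m : 'I_4) : uniq [:: i; j; l; m] -> forall z, z \in [:: i; j; l; m].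
Proof.
move=> u z; have /card_uniqP/= c4 := u.
have e : #|[:: i; j; l; m]| = #|'I_4| by rewrite c4 card_ord.
by have /(subset_cardP e) -> : [:: i; j; l; m] \subset 'I_4 by apply/subsetP.
Qed.

Lemma uniq4P (i j l m : 'I_4) : uniq [:: i; j; l; m] ->
  [/\ i != j, i != l & i != m] /\ [/\ j != l, j != m & l != m].
Proof.
rewrite /= !inE !negb_or andbT => /andP[/and3P[? ? ?] /andP[/andP[? ?] ?]].
by split.
Qed.

(** Multiplication in the Klein group {0, 1, 2, 3}, with 0 as unit: the bitwise
    exclusive disjunction. *)
Definition klein_table := [:: [:: 0; 1; 2; 3]; [:: 1; 0; 3; 2]; [:: 2; 3; 0; 1]; [:: 3; 2; 1; 0]]%N.
Definition kmul (i j : 'I_4) : 'I_4 := inord (nth 0%N (nth [::] klein_table i) j).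

Ltac ord4_cases := repeat (let i := fresh "i" in let h := fresh in
  intro i; case: i => [[|[|[|[|i]]]] h] //).

Lemma kmulA i j l : kmul i (kmul j l) = kmul (kmul i j) l.
Proof.
move: i j l; ord4_cases; apply/val_inj; rewrite /kmul /= ?inordK //.
Qed.

Lemma kmul0 i : kmul i ord0 = i.
Proof. by move: i; ord4_cases; apply/val_inj; rewrite /kmul /= inordK. Qed.

Lemma kmul0l i : kmul ord0 i = i.
Proof. by move: i; ord4_cases; apply/val_inj; rewrite /kmul /= inordK. Qed.

Lemma kmulii i : kmul i i = ord0.
Proof. by move: i; ord4_cases; apply/val_inj; rewrite /kmul /= inordK. Qed.

Lemma kmul_third (i j : 'I_4) : i != ord0 -> j != ord0 -> i != j ->
  uniq [:: ord0; i; j; kmul i j].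
Proof.
by move: i j; ord4_cases; rewrite /= !inE -!val_eqE /kmul /= inordK.
Qed.

(** The product of two distinct nonzero elements is the third one. *)
Lemma kmul_eq_third (i j l : 'I_4) : uniq [:: ord0; i; j; l] -> kmul i j = l.
Proof.
move=> u; have := mem_uniq4 u (kmul i j).
have [[i0 j0 _] [ij _ _]] := uniq4P u.
rewrite eq_sym in i0; rewrite eq_sym in j0.
have [[_ _ m0] [_ im jm]] := uniq4P (kmul_third i0 j0 ij).
rewrite !inE eq_sym (negbTE m0) eq_sym (negbTE im) eq_sym (negbTE jm) /=.
by move/eqP.
Qed.

(** Every permutation that fixes 0 is an automorphism of the Klein group. *)
Lemma kmul_perm (q : {perm 'I_4}) i j : q ord0 = ord0 ->
  q (kmul i j) = kmul (q i) (q j).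
Proof.
move=> q0; have [->|i0] := eqVneq i ord0; first by rewrite q0 !kmul0l.
have [->|j0] := eqVneq j ord0; first by rewrite q0 !kmul0.
have [->|ij] := eqVneq i j; first by rewrite !kmulii.
apply/esym/kmul_eq_third; rewrite -[X in X :: _]q0.
by rewrite -[_ :: _]/(map q [:: ord0; i; j; kmul i j]) map_inj_uniq ?kmul_third //; exact: perm_inj.
Qed.

Lemma kmul_inj i : injective (kmul^~ i).
Proof. by move=> x y /(congr1 (kmul^~ i)); rewrite -!kmulA kmulii !kmul0. Qed.

Definition kperm i : {perm 'I_4} := perm (@kmul_inj i).

Lemma kpermE i z : kperm i z = kmul z i.
Proof. by rewrite permE. Qed.

Section FourGroupPermutations.
Local Open Scope group_scope.

Lemma kperm_mul i j : kperm i * kperm j = kperm (kmul i j).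
Proof. by apply/permP => z; rewrite permM !kpermE kmulA. Qed.

Lemma kperm0 : kperm ord0 = 1.
Proof. by apply/permP => z; rewrite perm1 kpermE kmul0. Qed.

Lemma kperm_conj (q : {perm 'I_4}) i : q ord0 = ord0 -> kperm i * q = q * kperm (q i).
Proof. by move=> q0; apply/permP => z; rewrite !permM !kpermE kmul_perm. Qed.

(** S_4 is the semidirect product of the stabilizer of 0 and the translations kperm
    of the Klein group. *)
Definition stab_part (s : {perm 'I_4}) := s * kperm (s ord0).

Lemma stab_part0 s : stab_part s ord0 = ord0.
Proof. by rewrite permM kpermE kmulii. Qed.

Lemma stab_partK s : s = stab_part s * kperm (s ord0).
Proof. by rewrite -mulgA kperm_mul kmulii kperm0 mulg1. Qed.

End FourGroupPermutations.

(** * The action of S_4 *)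

(** Three linear functions with sum zero, indexed by the nonzero elements of the
    Klein group; the index 0 stands for the point U = oo of the fibre. *)
Definition lin3 (R : zmodType) (a b : R) (i : 'I_4) : R := [:: 0; a; b; - a - b]`_i.

Lemma lin3_sum (R : zmodType) (a b : R) : \sum_i lin3 a b i = 0.
Proof.
by rewrite !big_ord_recl big_ord0 /lin3 /= addr0 add0r addrA -opprD subrr.
Qed.

Lemma lin3E (R : zmodType) (a b : R) : [/\ lin3 a b ord0 = 0,
  lin3 a b (inord 1) = a, lin3 a b (inord 2) = b & lin3 a b (inord 3) = - a - b].
Proof. by rewrite /lin3 !inordK. Qed.

(** Only the first two functions are coordinates; the third one is permuted along
    with them because the sum of the three is invariant. *)
Lemma lin3_perm (R : zmodType) (a b : R) (q : {perm 'I_4}) i : q ord0 = ord0 ->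
  lin3 (lin3 a b (q (inord 1))) (lin3 a b (q (inord 2))) i = lin3 a b (q i).
Proof.
move=> q0; move: i; apply: ord4P.
- by have [-> _ _ _] := lin3E (lin3 a b (q (inord 1))) (lin3 a b (q (inord 2)));
    rewrite q0; have [->] := lin3E a b.
- by have [_ -> _ _] := lin3E (lin3 a b (q (inord 1))) (lin3 a b (q (inord 2))).
- by have [_ _ -> _] := lin3E (lin3 a b (q (inord 1))) (lin3 a b (q (inord 2))).
have [_ _ _ ->] := lin3E (lin3 a b (q (inord 1))) (lin3 a b (q (inord 2))).
have h := lin3_sum a b; rewrite (reindex_inj (@perm_inj _ q)) in h.
rewrite !big_ord_recl big_ord0 /= addr0 q0 in h.
have [l0 _ _ _] := lin3E a b; rewrite l0 add0r in h.
have e1 : lift ord0 ord0 = inord 1 :> 'I_4 by apply/val_inj; rewrite /= inordK.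
have e2 : lift ord0 (lift ord0 ord0) = inord 2 :> 'I_4.
  by apply/val_inj; rewrite /= inordK.
have e3 : lift ord0 (lift ord0 (lift ord0 ord0)) = inord 3 :> 'I_4.
  by apply/val_inj; rewrite /= inordK.
rewrite e1 e2 e3 addrA in h; apply/esym/eqP.
by rewrite -opprD -addr_eq0 addrC h.
Qed.

(** The unit stands in for tuples that are not birational.  This definition and the
    next two locked ones are opaque for the same reason as evaluation. *)
HB.lock Definition of_tup (C : fieldType) (f : 4.-tuple {mpoly C[4]}) : Bir C 3 :=
  if pselect (birational f) is left b then \pi_(Bir C 3) (mk_birat b) else 1%g.

Section Tuples.
Variables (C : fieldType) (n' : nat).
Notation n := n'.+1.
Notation pol := {mpoly C[4]}.

(** The product of the differences of f j with the other two values. *)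
Definition delta (R : comNzRingType) (f : 'I_4 -> R) (j : 'I_4) : R :=
  \prod_(i | (i != ord0) && (i != j)) (f i - f j).

Definition linX (i : 'I_4) : pol := lin3 'X_(inord 1) 'X_(inord 2) i.

Definition stab_tup (q : {perm 'I_4}) : 4.-tuple pol :=
  [tuple [:: 'X_ord0; linX (q (inord 1)); linX (q (inord 2)); 'X_(inord 3)]`_i | i < 4].

(** Numerator and denominator of t j + delta t j / (U - t j), the image of U under the
    involution that exchanges U = oo with U = t j and exchanges the other two
    points; both are made homogeneous with powers of w0. *)
Definition klein_num (R : comNzRingType) (j : 'I_4) (w0 u : R) (p : 'I_4 -> R) :=
  p j * (w0 ^+ n' * u - p j) + delta p j.

Definition klein_den (R : comNzRingType) (j : 'I_4) (w0 u : R) (p : 'I_4 -> R) :=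
  w0 ^+ n' * (w0 ^+ n' * u - p j).

Definition klein_tup (j : 'I_4) : 4.-tuple pol :=
  let p i := linX i ^+ n in
  let d := klein_den j 'X_ord0 'X_(inord 3) p in
  [tuple [:: d * 'X_ord0; d * 'X_(inord 1); d * 'X_(inord 2);
     klein_num j 'X_ord0 'X_(inord 3) p]`_i | i < 4].

End Tuples.

HB.lock Definition stab_bir (C : fieldType) (q : {perm 'I_4}) : Bir C 3 :=
  of_tup (stab_tup C q).

HB.lock Definition klein_bir (C : fieldType) (n' : nat) (j : 'I_4) : Bir C 3 :=
  if j == ord0 then 1%g else of_tup (klein_tup C n' j).

Section Representation.
Variables (C F : fieldType) (G : coordinates C 3 F) (n' : nat).
Notation n := n'.+1.
Notation pol := {mpoly C[4]}.
Notation linX := (linX C).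
Notation stab_tup := (stab_tup C).
Notation klein_tup := (klein_tup C n').
Notation klein_num := (klein_num n').
Notation klein_den := (klein_den n').
Notation stab_bir := (stab_bir C).
Notation klein_bir := (klein_bir C n').
Notation evat w := (eval (cst G) w).
Notation v := (coord G).
Notation U := (v (inord 3)).

Notation c := (lin3 (v (inord 1)) (v (inord 2))).
Notation t i := (c i ^+ n).

Hypothesis t_inj : forall i j : 'I_4, i != ord0 -> j != ord0 -> i != j ->
  t i - t j != 0.
Hypothesis tU : forall i : 'I_4, i != ord0 -> U - t i != 0.

Lemma act_of_tup f i : birational f ->
  act G (of_tup f) (v i) = at_generic G f i / at_generic G f ord0.
Proof.
move=> bf; rewrite of_tup.unlock; case: pselect => // bf'.
by rewrite actE pullback_coord.
Qed.

Lemma linX_homog i : linX i \is 1.-homog.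
Proof.
move: i; apply: ord4P; rewrite /linX /lin3 ?inordK //=; last first.
- by rewrite -opprD dhomogN; apply: rpredD; exact: homogX.
- exact: homogX.
- exact: homogX.
- exact: rpred0.
Qed.

Lemma eval_linX w i : evat w (linX i) = lin3 (w (inord 1)) (w (inord 2)) i.
Proof.
move: i; apply: ord4P; rewrite /linX /lin3 ?inordK //= ?rmorph0 ?evalX //.
by rewrite rmorphB rmorphN /= !evalX.
Qed.

Lemma stab_tup_homog q i : tnth (stab_tup q) i \is 1.-homog.
Proof.
rewrite tnth_mktuple; move: i; apply: ord4P; rewrite ?inordK //=;
  by [exact: homogX | exact: linX_homog].
Qed.

Lemma at_stab q : [/\ at_generic G (stab_tup q) ord0 = 1,
  at_generic G (stab_tup q) (inord 1) = c (q (inord 1)),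
  at_generic G (stab_tup q) (inord 2) = c (q (inord 2))
  & at_generic G (stab_tup q) (inord 3) = U].
Proof.
by rewrite /at_generic !tnth_mktuple !inordK //= !eval_linX !evalX coord0.
Qed.

Lemma stab_tupV (p q : {perm 'I_4}) : q ord0 = ord0 -> (forall i, q (p i) = i) ->
  forall i, evat (at_generic G (stab_tup q)) (tnth (stab_tup p) i) = 1 * v i.
Proof.
move=> q0 pK; have [w0 w1 w2 w3] := at_stab q.
have [_ c1 c2 _] := lin3E (v (inord 1)) (v (inord 2)).
apply: ord4P; rewrite mul1r tnth_mktuple ?inordK //= ?evalX ?w0 ?w3 ?coord0 //.
- by rewrite eval_linX w1 w2 lin3_perm // pK c1.
- by rewrite eval_linX w1 w2 lin3_perm // pK c2.
Qed.

Lemma birational_stab (q : {perm 'I_4}) : q ord0 = ord0 -> birational (stab_tup q).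
Proof.
move=> q0; have q'0 : (q^-1)%g ord0 = ord0 by rewrite -{1}q0 permK.
apply: (birational_ev (stab_tup_homog q) (stab_tup_homog (q^-1)%g) (G := G)).
  by exists 1; [exact: oner_neq0 | apply: stab_tupV => // i; rewrite permK].
by exists 1; [exact: oner_neq0 | apply: stab_tupV => // i; rewrite permKV].
Qed.

Lemma act_stab (q : {perm 'I_4}) : q ord0 = ord0 ->
  act G (stab_bir q) U = U /\ forall i, act G (stab_bir q) (c i) = c (q i).
Proof.
move=> q0; have bq := birational_stab q0; have [w0 w1 w2 w3] := at_stab q.
rewrite stab_bir.unlock.
have a1 : act G (of_tup (stab_tup q)) (v (inord 1)) = c (q (inord 1)).
  by rewrite act_of_tup // w0 w1 divr1.
have a2 : act G (of_tup (stab_tup q)) (v (inord 2)) = c (q (inord 2)).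
  by rewrite act_of_tup // w0 w2 divr1.
split; first by rewrite act_of_tup // w0 w3 divr1.
move=> i; rewrite -lin3_perm // -a1 -a2.
by move: i; apply: ord4P; rewrite /lin3 ?inordK //= ?rmorph0 // rmorphB rmorphN.
Qed.

Lemma homog_exp (p : pol) d : p \is 1.-homog -> p ^+ d \is d.-homog.
Proof. by move=> hp; have := dhomogMn d hp; rewrite mul1n. Qed.

Lemma delta_third (R : comNzRingType) (f : 'I_4 -> R) i j l :
  uniq [:: ord0; i; j; l] -> delta f l = (f i - f l) * (f j - f l).
Proof.
move=> u; have [[i0 j0 l0] [ij il jl]] := uniq4P u.
rewrite /delta (bigD1 i) /= 1?eq_sym ?i0 // ?il //.
rewrite (bigD1 j) /=; last by rewrite eq_sym j0 jl eq_sym ij.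
rewrite big_pred0 ?mulr1 // => z; have := mem_uniq4 u z; rewrite !inE.
by case/or4P=> /eqP ->; rewrite ?eqxx ?andbF.
Qed.

Lemma klein_others (j : 'I_4) : j != ord0 -> exists i l, uniq [:: ord0; i; l; j].
Proof.
move: j; apply: ord4P => //_.
- by exists (inord 2), (inord 3); rewrite /= !inE -!val_eqE /= !inordK.
- by exists (inord 1), (inord 3); rewrite /= !inE -!val_eqE /= !inordK.
- by exists (inord 1), (inord 2); rewrite /= !inE -!val_eqE /= !inordK.
Qed.

Lemma klein_tup_homog j i : j != ord0 -> tnth (klein_tup j) i \is (n + n).-homog.
Proof.
move=> j0; rewrite tnth_mktuple.
have hp l : linX l ^+ n \is n.-homog by apply/homog_exp/linX_homog.
have hs : 'X_ord0 ^+ n' * 'X_(inord 3) - linX j ^+ n \is n.-homog.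
  apply: rpredB => //; rewrite -(addn1 n'); apply: dhomogM; last exact: homogX.
  exact/homog_exp/homogX.
have hd : klein_den j 'X_ord0 'X_(inord 3) (fun i => linX i ^+ n) \is (n' + n).-homog.
  by apply: dhomogM hs; exact/homog_exp/homogX.
have hdX l : klein_den j 'X_ord0 'X_(inord 3) (fun i => linX i ^+ n) * 'X_l
    \is (n + n).-homog.
  rewrite (_ : n + n = n' + n + 1)%N; last by rewrite addn1.
  by apply: dhomogM hd _; exact: homogX.
move: i; apply: ord4P; rewrite ?inordK //=.
have [i [l u]] := klein_others j0.
rewrite /klein_num (delta_third _ u); apply: rpredD; apply: dhomogM => //;
  exact: rpredB.
Qed.

Lemma rmorph_delta (R S : comNzRingType) (f : {rmorphism R -> S}) (p : 'I_4 -> R) j :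
  f (delta p j) = delta (fun i => f (p i)) j.
Proof. by rewrite rmorph_prod; apply: eq_bigr => i _; rewrite rmorphB. Qed.

Lemma eq_delta (R : comNzRingType) (p q : 'I_4 -> R) j : p =1 q -> delta p j = delta q j.
Proof. by move=> e; apply: eq_bigr => i _; rewrite !e. Qed.

Lemma eval_mulX w (d : pol) i : evat w (d * 'X_i) = evat w d * w i.
Proof. by rewrite rmorphM /= evalX. Qed.

Lemma eval_klein_den w j :
  evat w (klein_den j 'X_ord0 'X_(inord 3) (fun i => linX i ^+ n)) =
  klein_den j (w ord0) (w (inord 3)) (fun i => lin3 (w (inord 1)) (w (inord 2)) i ^+ n).
Proof. by rewrite rmorphM rmorphB rmorphM !rmorphXn /= !evalX eval_linX. Qed.

Lemma eval_klein_num w j :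
  evat w (klein_num j 'X_ord0 'X_(inord 3) (fun i => linX i ^+ n)) =
  klein_num j (w ord0) (w (inord 3)) (fun i => lin3 (w (inord 1)) (w (inord 2)) i ^+ n).
Proof.
rewrite rmorphD rmorphM rmorphB rmorphM !rmorphXn /= rmorph_delta !evalX eval_linX.
by congr (_ + _); apply: eq_delta => i; rewrite rmorphXn /= eval_linX.
Qed.

Notation dl j := (delta (fun i => t i) j).

Lemma at_klein j : [/\ at_generic G (klein_tup j) ord0 = U - t j,
  at_generic G (klein_tup j) (inord 1) = (U - t j) * v (inord 1),
  at_generic G (klein_tup j) (inord 2) = (U - t j) * v (inord 2)
  & at_generic G (klein_tup j) (inord 3) = t j * (U - t j) + dl j].
Proof.
rewrite /at_generic !tnth_mktuple !inordK //= !eval_mulX !eval_klein_den.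
rewrite eval_klein_num /klein_den /klein_num coord0 expr1n !mul1r mulr1.
by split.
Qed.

Lemma delta_neq0 j : j != ord0 -> dl j != 0.
Proof.
move=> j0; have [i [l u]] := klein_others j0; rewrite (delta_third _ u).
have [[i0 l0 _] [_ ij lj]] := uniq4P u; rewrite eq_sym in i0; rewrite eq_sym in l0.
by rewrite mulf_neq0 ?t_inj.
Qed.

Lemma lin3_scale (R : comNzRingType) (a b d : R) i : lin3 (d * a) (d * b) i = d * lin3 a b i.
Proof.
by move: i; apply: ord4P; rewrite /lin3 ?inordK //= ?mulr0 // mulrBr mulrN.
Qed.

Lemma klein_involution j : j != ord0 -> exists2 a, a != 0 & forall i,
  evat (at_generic G (klein_tup j)) (tnth (klein_tup j) i) = a * v i.
Proof.
move=> j0; have [w0 w1 w2 w3] := at_klein j; set w := at_generic G _ in w0 w1 w2 w3 *.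
set d := U - t j in w0 w1 w2 w3.
have d0 : d != 0 := tU j0.
have et i : lin3 (w (inord 1)) (w (inord 2)) i ^+ n = d ^+ n * t i.
  by rewrite w1 w2 lin3_scale exprMn.
have eden : klein_den j (w ord0) (w (inord 3))
    (fun i => lin3 (w (inord 1)) (w (inord 2)) i ^+ n) = d ^+ n' * d ^+ n' * dl j.
  rewrite /klein_den et w0 w3 (exprS d n').
  by set e := d ^+ n'; set a := t j; ring.
have edl : delta (fun i => lin3 (w (inord 1)) (w (inord 2)) i ^+ n) j =
    d ^+ n * d ^+ n * dl j.
  have [i [l u]] := klein_others j0.
  by rewrite (eq_delta _ et) !(delta_third _ u) -!mulrBr mulrACA.
have enum : klein_num j (w ord0) (w (inord 3))
    (fun i => lin3 (w (inord 1)) (w (inord 2)) i ^+ n) =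
    d ^+ n' * d ^+ n' * dl j * d * U.
  have -> : U = d + t j by rewrite /d subrK.
  rewrite /klein_num edl et w0 w3 (exprS d n').
  by set e := d ^+ n'; set a := t j; ring.
exists (d ^+ n' * d ^+ n' * dl j * d).
  by rewrite !mulf_neq0 ?expf_neq0 ?delta_neq0.
apply: ord4P; rewrite tnth_mktuple ?inordK //= ?eval_mulX ?eval_klein_den
  ?eval_klein_num ?eden ?enum ?w0 ?w1 ?w2 ?mulrA ?coord0 ?mulr1 //.
Qed.

Lemma birational_klein j : j != ord0 -> birational (klein_tup j).
Proof.
move=> j0; have h := klein_involution j0.
exact: (birational_ev (fun i => klein_tup_homog i j0) (fun i => klein_tup_homog i j0) h h).
Qed.

Lemma klein_bir0 : klein_bir ord0 = 1%g.
Proof. by rewrite klein_bir.unlock eqxx. Qed.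

Lemma klein_birE j : j != ord0 -> klein_bir j = of_tup (klein_tup j).
Proof. by move=> /negbTE j0; rewrite klein_bir.unlock j0. Qed.

Lemma act_klein j : j != ord0 ->
  act G (klein_bir j) U = t j + dl j / (U - t j) /\
  forall i, act G (klein_bir j) (c i) = c i.
Proof.
move=> j0; have bj := birational_klein j0; have [w0 w1 w2 w3] := at_klein j.
have d0 := tU j0; rewrite klein_birE //.
have a1 : act G (of_tup (klein_tup j)) (v (inord 1)) = v (inord 1).
  by rewrite act_of_tup // w0 w1 mulrC mulKf.
have a2 : act G (of_tup (klein_tup j)) (v (inord 2)) = v (inord 2).
  by rewrite act_of_tup // w0 w2 mulrC mulKf.
split; first by rewrite act_of_tup // w0 w3 mulrDl mulfK.
by apply: ord4P; rewrite /lin3 ?inordK //= ?rmorph0 // rmorphB rmorphN /= a1 a2.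
Qed.

Lemma act_klein_c j i : act G (klein_bir j) (c i) = c i.
Proof.
have [->|j0] := eqVneq j ord0; first by rewrite klein_bir0 act_one.
exact: (act_klein j0).2.
Qed.

Lemma bir_eqP (x y : Bir C 3) : act G x U = act G y U ->
  (forall i, act G x (c i) = act G y (c i)) -> x = y.
Proof.
move=> eU ec; apply: (act_coord_inj (G := G)); have [_ c1 c2 _] := lin3E (v (inord 1)) (v (inord 2)).
apply: ord4P; last exact: eU.
- by rewrite coord0 !rmorph1.
- by have := ec (inord 1); rewrite c1.
- by have := ec (inord 2); rewrite c2.
Qed.

Lemma stab_mul (p q : {perm 'I_4}) : p ord0 = ord0 -> q ord0 = ord0 ->
  (stab_bir p * stab_bir q)%g = stab_bir (p * q)%g.
Proof.
move=> p0 q0; have pq0 : (p * q)%g ord0 = ord0 by rewrite permM p0 q0.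
have [pU pc] := act_stab p0; have [qU qc] := act_stab q0; have [pqU pqc] := act_stab pq0.
apply: bir_eqP => [|i]; first by rewrite act_mul pU qU pqU.
by rewrite act_mul pc qc pqc permM.
Qed.

(** A projective involution of the fibre that permutes four points is determined by
    the permutation; for i != j the composite is computed from the fact that each
    delta is a product of two differences. *)
Lemma klein_mul i j : (klein_bir i * klein_bir j)%g = klein_bir (kmul i j).
Proof.
have [->|i0] := eqVneq i ord0; first by rewrite kmul0l klein_bir0 mul1g.
have [->|j0] := eqVneq j ord0; first by rewrite kmul0 klein_bir0 mulg1.
apply: bir_eqP => [|l]; last by rewrite act_mul !act_klein_c.
have ti l : act G (klein_bir j) (t l) = t l by rewrite rmorphXn /= act_klein_c.
have [iU _] := act_klein i0; have [jU _] := act_klein j0.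
have ei := tU i0; have ej := tU j0.
have ejU : act G (klein_bir j) (dl i) = dl i.
  by rewrite rmorph_delta; apply: eq_delta => l; exact: ti.
rewrite act_mul iU rmorphD fmorph_div rmorphB /= ejU jU !ti.
have [<-|ij] := eqVneq i j.
  rewrite kmulii klein_bir0 act_one.
  have -> : t i + dl i / (U - t i) - t i = dl i / (U - t i) by rewrite addrAC subrr add0r.
  by rewrite invf_div mulrCA divff ?delta_neq0 // mulr1 addrC subrK.
have u := kmul_third i0 j0 ij; set l := kmul i j in u *.
have [[_ _ l0] [_ il jl]] := uniq4P u; rewrite eq_sym in l0.
have [lU _] := act_klein l0; have el := tU l0.
have uj : uniq [:: ord0; i; l; j] by rewrite (perm_uniq (s2 := [:: ord0; i; j; l])) // perm_cons perm_cons (perm_catC [:: l] [:: j]).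
have ui : uniq [:: ord0; j; l; i] by rewrite (perm_uniq (s2 := [:: ord0; i; j; l])) // perm_cons (perm_catC [:: j; l] [:: i]).
rewrite lU (delta_third _ u) (delta_third _ uj) (delta_third _ ui).
have tij := t_inj i0 j0 ij.
move: (t i) (t j) (t l) U ei ej el tij => a b d x xa xb xd ab.
field; rewrite xb xd /=.
rewrite (_ : _ + _ = - ((a - b) * (x - d))); last by ring.
by rewrite oppr_eq0 mulf_neq0.
Qed.

Lemma klein_stab i (q : {perm 'I_4}) : q ord0 = ord0 ->
  (klein_bir i * stab_bir q)%g = (stab_bir q * klein_bir (q i))%g.
Proof.
move=> q0; have [->|i0] := eqVneq i ord0; first by rewrite q0 klein_bir0 mul1g mulg1.
have qi0 : q i != ord0 by rewrite -q0 (inj_eq perm_inj).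
have [qU qc] := act_stab q0.
have tq l : act G (stab_bir q) (t l) = t (q l) by rewrite rmorphXn /= qc.
apply: bir_eqP => [|l]; last by rewrite !act_mul act_klein_c !qc act_klein_c.
have [iU _] := act_klein i0; have [qiU _] := act_klein qi0.
have edl : act G (stab_bir q) (dl i) = dl (q i).
  rewrite rmorph_delta /delta [RHS](reindex_inj (@perm_inj _ q)) /=.
  apply: eq_big => [l|l _]; last by rewrite !tq.
  by rewrite -[X in _ = (_ != X) && _]q0 !(inj_eq perm_inj).
by rewrite !act_mul iU qU qiU rmorphD fmorph_div rmorphB /= edl qU !tq.
Qed.

(** The composite of the two actions, along the decomposition of s by stab_part. *)
Definition rep (s : {perm 'I_4}) : Bir C 3 :=
  (stab_bir (stab_part s) * klein_bir (s ord0))%g.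

Lemma rep_klein j : rep (kperm j) = klein_bir j.
Proof.
rewrite /rep /stab_part kpermE kmul0l kperm_mul kmulii kperm0.
have -> : stab_bir 1%g = 1%g; last by rewrite mul1g.
have [oU oc] := @act_stab 1%g (perm1 _).
by apply: bir_eqP => [|i]; rewrite act_one ?oU // oc perm1.
Qed.

Lemma rep_mul s r : rep (s * r)%g = (rep s * rep r)%g.
Proof.
have e1 : stab_part (s * r) = (stab_part s * stab_part r)%g /\
    (s * r)%g ord0 = kmul (stab_part r (s ord0)) (r ord0).
  have e0 : (s * r)%g ord0 = kmul (stab_part r (s ord0)) (r ord0).
    by rewrite permM [r in LHS]stab_partK permM kpermE.
  split=> //; rewrite [LHS]/stab_part e0 {1}(stab_partK s) {1}(stab_partK r).
  move: (stab_part0 r).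
  move: (stab_part s) (stab_part r) (s ord0) (r ord0) => p q i j q0.
  rewrite -!mulgA kperm_mul (mulgA (kperm i)) (kperm_conj _ q0) -mulgA kperm_mul.
  by rewrite kmulA kmulii kperm0 mulg1.
rewrite /rep e1.1 e1.2; move: (stab_part0 s) (stab_part0 r).
move: (stab_part s) (stab_part r) (s ord0) (r ord0) => p q i j p0 q0.
by rewrite -stab_mul // -klein_mul -!mulgA; congr mulg; rewrite !mulgA klein_stab.
Qed.

Hypothesis tU2 : forall j : 'I_4, j != ord0 -> (U - t j) ^+ 2 != dl j.

Lemma rep_kernel s : rep s = 1%g -> s = 1%g.
Proof.
move=> rs; have p0 := stab_part0 s; have [pU pc] := act_stab p0.
have p1 : stab_part s = 1%g.
  apply/permP => i; rewrite perm1; have [->|i0] := eqVneq i ord0; first exact: p0.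
  have pi0 : stab_part s i != ord0 by rewrite -[X in _ != X]p0 (inj_eq perm_inj).
  apply/eqP; apply: contraT => ne; have := t_inj pi0 i0 ne.
  have := congr1 (fun x => act G x (c i)) rs.
  by rewrite act_one act_mul pc act_klein_c => ->; rewrite subrr eqxx.
rewrite (stab_partK s) p1 mul1g; have [->|s0] := eqVneq (s ord0) ord0; first exact: kperm0.
have [sU _] := act_klein s0; have := tU2 s0.
(* An involution that fixes U = t + delta / (U - t) has (U - t) ^ 2 = delta. *)
have := congr1 (fun x => act G x U) rs.
rewrite act_one act_mul pU sU => /(canRL (addKr _))/(canRL (divfK (tU s0))) ->.
by rewrite addrC expr2 eqxx.
Qed.

Lemma rep_one : rep 1%g = 1%g.
Proof. by rewrite -kperm0 rep_klein klein_bir0. Qed.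

Lemma rep_inj : injective rep.
Proof.
move=> s r e; apply/eqP; rewrite eq_mulgV1; apply/eqP/rep_kernel.
by rewrite rep_mul e -rep_mul mulgV rep_one.
Qed.

Definition rep_morphism : {multiplicative {perm 'I_4} -> Bir C 3} :=
  HB.pack rep (isMultiplicative.Build {perm 'I_4} (Bir C 3) rep rep_mul).

End Representation.

Section ImageSubgroup.
Local Open Scope group_scope.
Variables (gT G : groupType) (f : {multiplicative gT -> G}).

Definition im_pred : {pred G} := fun x => `[< exists s, f s = x >].

Let f1 : f 1 = 1.
Proof. by apply: (mulgI (f 1)); rewrite -gmulfM !mulg1. Qed.

Let im_mul : mulg_closed im_pred.
Proof.
move=> x y /asboolP[s <-] /asboolP[r <-]; apply/asboolP; exists (s * r).
exact: gmulfM.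
Qed.

Let im_one : 1 \in im_pred.
Proof. by apply/asboolP; exists 1. Qed.

Let im_inv : invg_closed im_pred.
Proof.
move=> x /asboolP[s <-]; apply/asboolP; exists s^-1.
by apply: (mulgI (f s)); rewrite -gmulfM !mulgV f1.
Qed.

HB.instance Definition _ := isMulClosed.Build G im_pred im_mul.
HB.instance Definition _ := isMul1Closed.Build G im_pred im_one.
HB.instance Definition _ := isInvClosed.Build G im_pred im_inv.

Definition im_group : groupClosed G := im_pred.

Lemma im_groupP x : x \in im_group <-> exists s, f s = x.
Proof. by split=> [/asboolP|h] //; apply/asboolP. Qed.

End ImageSubgroup.

(** * Squares in S_4 *)

Section KleinSquares.
Local Open Scope group_scope.

Definition four_cycle_fun (i : 'I_4) : 'I_4 := inord (nth 0%N [:: 2; 3; 1; 0]%N i).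

Lemma four_cycle_inj : injective four_cycle_fun.
Proof.
move=> i j /(congr1 val); rewrite /four_cycle_fun; move: i j; ord4_cases;
  by rewrite /= ?inordK // => _; apply/val_inj.
Qed.

Lemma klein_square : exists r : {perm 'I_4}, r * r = kperm (inord 1).
Proof.
exists (perm four_cycle_inj); apply/permP => i; rewrite permM !permE.
by move: i; ord4_cases; apply/val_inj; rewrite /four_cycle_fun /kmul /= !inordK.
Qed.

(** The statement of square_involution for the list of values of a permutation, to
    be checked on all lists. *)
Definition square_check (l : seq nat) :=
  let s z := nth 0%N l (nth 0%N l z) in
  [&& uniq l, all (fun z => s (s z) == z) (iota 0 4)
    & ~~ all (fun z => s z == z) (iota 0 4)] ==>
  all (fun z => s z == nth 0%N (nth [::] klein_table z) (s 0%N)) (iota 0 4).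

Lemma square_checkP : all (fun a => all (fun b => all (fun c => all (fun d =>
  square_check [:: a; b; c; d]) (iota 0 4)) (iota 0 4)) (iota 0 4)) (iota 0 4).
Proof. by vm_compute. Qed.

(** The involutions of S_4 that are squares are the double transpositions. *)
Lemma square_involution (r : {perm 'I_4}) : (r * r) * (r * r) = 1 -> r * r <> 1 ->
  exists2 j, j != ord0 & r * r = kperm j.
Proof.
move=> r4 r2.
pose l := [:: val (r ord0); val (r (inord 1)); val (r (inord 2)); val (r (inord 3))].
have lE z : val (r z) = nth 0%N l (val z) by move: z; apply: ord4P; rewrite /l /= ?inordK.
have sE z : val ((r * r) z) = nth 0%N l (nth 0%N l (val z)) by rewrite permM !lE.
have mem4 (z : 'I_4) : val z \in iota 0 4 by rewrite mem_iota /= ltn_ord.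
have chk : square_check l.
  have /allP/(_ _ (mem4 (r ord0)))/allP/(_ _ (mem4 (r (inord 1)))) := square_checkP.
  by move=> /allP/(_ _ (mem4 (r (inord 2))))/allP/(_ _ (mem4 (r (inord 3)))).
have ul : uniq l.
  rewrite -[l]/(map val (map r [:: ord0; inord 1; inord 2; inord 3])).
  rewrite (map_inj_uniq val_inj) (map_inj_uniq perm_inj).
  by rewrite /= !inE -!val_eqE /= !inordK.
have all4 (P : pred nat) : (forall z : 'I_4, P (val z)) -> all P (iota 0 4).
  by move=> h; apply/allP => z; rewrite mem_iota => lt_z; exact: (h (Ordinal lt_z)).
have h1 : all (fun z => nth 0%N l (nth 0%N l (nth 0%N l (nth 0%N l z))) == z) (iota 0 4).
  by apply: all4 => z; rewrite -sE -sE -permM r4 perm1.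
have h2 : ~~ all (fun z => nth 0%N l (nth 0%N l z) == z) (iota 0 4).
  apply/negP => /allP h; apply: r2; apply/permP => z; rewrite perm1.
  by apply/val_inj; rewrite sE; apply/eqP/h/mem4.
move: chk; rewrite /square_check ul h1 h2 /= => chk.
have {}chk z : val ((r * r) z) = nth 0%N (nth [::] klein_table z) (val ((r * r) ord0)).
  have := mem4 z; rewrite sE [val ((r * r) ord0)]sE => mz; apply/eqP.
  by have /allP/(_ _ mz) : all (fun z => nth 0%N l (nth 0%N l z) ==
    nth 0%N (nth [::] klein_table z) (nth 0%N l (nth 0%N l 0%N))) (iota 0 4) by exact: chk.
have e : r * r = kperm ((r * r) ord0).
  by apply/permP => z; apply/val_inj; rewrite kpermE /kmul -chk inord_val.
exists ((r * r) ord0) => //; apply: contra_not_neq r2 => s0.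
by rewrite e s0 kperm0.
Qed.

End KleinSquares.

(** * The family of groups *)

Lemma rmorph_lin3 (R S : nzRingType) (f : {rmorphism R -> S}) a b i :
  f (lin3 a b i) = lin3 (f a) (f b) i.
Proof.
by move: i; apply: ord4P; rewrite /lin3 ?inordK //= ?rmorph0 // rmorphB rmorphN.
Qed.

Section Shift.
Variables (A : idomainType) (F : fieldType) (io : {rmorphism {poly A} -> F}) (b : A).
Hypothesis io_inj : injective io.
Hypothesis io_frac : forall z, exists p q, q != 0 /\ z = io p / io q.

(** Evaluation of polynomials at T = U - b instead of U. *)
Definition shift_eval : {poly A} -> F := io \o comp_poly ('X - b%:P).
HB.instance Definition _ := GRing.RMorphism.on shift_eval.

Let shiftK (p : {poly A}) : (p \Po ('X + b%:P)) \Po ('X - b%:P) = p.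
Proof. by rewrite -comp_polyA comp_polyD comp_polyX comp_polyC subrK comp_polyXr. Qed.

Let shiftVK (p : {poly A}) : (p \Po ('X - b%:P)) \Po ('X + b%:P) = p.
Proof. by rewrite -comp_polyA comp_polyB comp_polyX comp_polyC addrK comp_polyXr. Qed.

Lemma shift_eval_inj : injective shift_eval.
Proof.
by move=> p q /io_inj/(congr1 (fun r => r \Po ('X + b%:P))); rewrite !shiftVK.
Qed.

Lemma shift_eval_frac z : exists p q, q != 0 /\ z = shift_eval p / shift_eval q.
Proof.
have [p [q [q0 ->]]] := io_frac z.
exists (p \Po ('X + b%:P)), (q \Po ('X + b%:P)); rewrite /shift_eval /= !shiftK.
by split=> //; apply: contraNneq q0 => e; rewrite -[q]shiftK e comp_poly0.
Qed.

Lemma shift_evalC a : shift_eval a%:P = io a%:P.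
Proof. by rewrite /shift_eval /= comp_polyC. Qed.

Lemma shift_evalX : shift_eval 'X = io 'X - io b%:P.
Proof. by rewrite /shift_eval /= comp_polyX rmorphB. Qed.

End Shift.

Section BaseFunctions.
Variables (C : numClosedFieldType) (k : nat).
Notation A := {poly {poly C}}.
Notation n := (2 ^ k.+1)%N.

Definition base_lin (i : 'I_4) : A := lin3 ('X%:P) 'X i.

Let n0 : (0 < n)%N. Proof. by rewrite expn_gt0. Qed.

Let Xn0 : 'X ^+ n != 0 :> {poly C}.
Proof. by rewrite expf_neq0 // polyX_eq0. Qed.

Let even_n (a : {poly C}) : (- a) ^+ n = a ^+ n.
Proof. by rewrite expnS !exprM sqrrN. Qed.

Lemma base_lin_exp_inj (i j : 'I_4) : i != ord0 -> j != ord0 -> i != j ->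
  base_lin i ^+ n != base_lin j ^+ n.
Proof.
have [_ b1 b2 b3] := lin3E ('X%:P : A) 'X.
have h12 : base_lin (inord 1) ^+ n <> base_lin (inord 2) ^+ n.
  rewrite /base_lin b1 b2 => /(congr1 (horner^~ 0)).
  rewrite !horner_exp hornerC hornerX expr0n eqn0Ngt n0 /= => /eqP.
  exact/negP.
have h13 : base_lin (inord 1) ^+ n <> base_lin (inord 3) ^+ n.
  rewrite /base_lin b1 b3 => /(congr1 (horner^~ (- 'X))).
  rewrite !horner_exp hornerD !hornerN hornerC hornerX subrr expr0n eqn0Ngt n0 /= => /eqP.
  exact/negP.
have h23 : base_lin (inord 2) ^+ n <> base_lin (inord 3) ^+ n.
  rewrite /base_lin b2 b3 => /(congr1 (horner^~ 0)).
  rewrite !horner_exp hornerD !hornerN hornerC hornerX subr0 even_n expr0n eqn0Ngt n0 /=.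
  by move=> /esym/eqP; exact/negP.
move=> i0 j0 ij; apply/eqP; move: i i0 j j0 ij.
apply: ord4P => // _; apply: ord4P => // _; rewrite ?eqxx //= => _.
- by move/esym; apply: h12.
- by move/esym; apply: h13.
- by move/esym; apply: h23.
Qed.

End BaseFunctions.

Section KleinField.
Variables (C : numClosedFieldType) (k : nat) (F : fieldType).
Variable G : coordinates C 3 F.
Notation A := {poly {poly C}}.
Variable io : {rmorphism {poly A} -> F}.
Hypothesis io_inj : injective io.
Hypothesis io_frac : forall z, exists p q, q != 0 /\ z = io p / io q.
Hypotheses (G0 : forall a : C, cst G a = io a%:P%:P%:P)
  (G1 : coord G (inord 1) = io ('X%:P : A)%:P)
  (G2 : coord G (inord 2) = io ('X : A)%:P) (G3 : coord G (inord 3) = io 'X).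
Notation n := (2 ^ k.+1)%N.
Definition pred_exponent : nat := n.-1.
Notation n' := pred_exponent.
Notation v := (coord G).
Notation c i := (lin3 (v (inord 1)) (v (inord 2)) i).
Notation t i := (c i ^+ n'.+1).
Notation b i := (base_lin C i ^+ n).

Let nE : n'.+1 = n. Proof. by rewrite /pred_exponent prednK // expn_gt0. Qed.

Let cE i : c i = io (base_lin C i)%:P.
Proof. by rewrite G1 G2 /base_lin (rmorph_lin3 polyC) (rmorph_lin3 io). Qed.

Let tE i : t i = io (b i)%:P.
Proof. by rewrite nE cE -rmorphXn -polyC_exp. Qed.

Let io_eq0 p : (io p == 0) = (p == 0).
Proof. by rewrite -(rmorph0 io) (inj_eq io_inj). Qed.

Lemma t_inj (i j : 'I_4) : i != ord0 -> j != ord0 -> i != j -> t i - t j != 0.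
Proof.
move=> i0 j0 ij; rewrite !tE -rmorphB -polyCB io_eq0 polyC_eq0 subr_eq0.
exact: base_lin_exp_inj.
Qed.

Lemma tU (i : 'I_4) : i != ord0 -> v (inord 3) - t i != 0.
Proof. by move=> _; rewrite tE G3 -rmorphB io_eq0 polyXsubC_eq0. Qed.

Let deltaE j : delta (fun i => t i) j = io (delta (fun i => b i) j)%:P.
Proof.
rewrite (rmorph_delta polyC) (rmorph_delta io); apply: eq_delta => i.
exact: tE.
Qed.

Lemma tU2 (j : 'I_4) : j != ord0 ->
  (v (inord 3) - t j) ^+ 2 != delta (fun i => t i) j.
Proof.
move=> _; rewrite deltaE tE G3 -rmorphB -rmorphXn (inj_eq io_inj).
apply/eqP => /(congr1 (fun p : {poly A} => size p)).
by rewrite size_exp_XsubC size_polyC; case: (_ != 0).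
Qed.

Definition s4_rep : {multiplicative {perm 'I_4} -> Bir C 3} :=
  rep_morphism t_inj tU.

Lemma s4_rep_inj : injective s4_rep.
Proof. exact: (rep_inj t_inj tU tU2). Qed.

Lemma s4_repE j : s4_rep (kperm j) = klein_bir C n' j.
Proof. exact: (rep_klein G). Qed.

Notation sigma := (act G (klein_bir C n' (inord 1))).

Let o1 : inord 1 != ord0 :> 'I_4. Proof. by rewrite -val_eqE /= inordK. Qed.

Let sigmaK : involutive sigma.
Proof.
by move=> z; rewrite -act_mul (klein_mul t_inj tU) kmulii klein_bir0 act_one.
Qed.

Notation ioT := (shift_eval io (b (inord 1))).

Let sigmaA (a : A) : sigma (ioT a%:P) = ioT a%:P.
Proof.
rewrite shift_evalC; elim/poly_ind: a => [|a d IH]; first by rewrite polyC0 !rmorph0.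
have sY : sigma (io ('X : A)%:P) = io ('X : A)%:P.
  have := act_klein_c t_inj tU (inord 1) (inord 2).
  by have [_ _ -> _] := lin3E (v (inord 1)) (v (inord 2)); rewrite G2.
rewrite polyCD polyCM rmorphD rmorphM rmorphD rmorphM /= IH sY; congr (_ + _).
elim/poly_ind: d => [|d e IHd]; first by rewrite !polyC0 !rmorph0.
have sX : sigma (io ('X%:P : A)%:P) = io ('X%:P : A)%:P.
  have := act_klein_c t_inj tU (inord 1) (inord 1).
  by have [_ -> _ _] := lin3E (v (inord 1)) (v (inord 2)); rewrite G1.
rewrite !polyCD !polyCM !(rmorphD io) !(rmorphM io) rmorphD rmorphM /= IHd sX.
by congr (_ + _); rewrite -G0 act_cst.
Qed.

Let ioTX : ioT 'X = v (inord 3) - t (inord 1).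
Proof. by rewrite shift_evalX tE G3. Qed.

Let sigmaT : ioT 'X * sigma (ioT 'X) = ioT (disc C k)%:P.
Proof.
have [sU sc] := act_klein t_inj tU o1.
rewrite ioTX rmorphB /= sU rmorphXn /= sc addrAC subrr add0r mulrC divfK ?tU //.
rewrite deltaE shift_evalC; congr (io _%:P).
have u : uniq [:: ord0; inord 2; inord 3; inord 1 : 'I_4].
  by rewrite /= !inE -!val_eqE /= !inordK.
rewrite (delta_third _ u) /disc /base_lin.
by have [_ -> -> ->] := lin3E ('X%:P : A) 'X.
Qed.

Lemma klein_many_classes : many_classes sigma #|{ffun 'I_k -> bool}|.
Proof.
exact: (many_classes_disc (@shift_eval_inj _ _ _ (base_lin C (inord 1) ^+ n) io_inj) (shift_eval_frac (base_lin C (inord 1) ^+ n) io_frac)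
  sigmaK sigmaA sigmaT).
Qed.

Lemma klein_finitely_many :
  exists m, forall M, many_classes sigma M -> (M <= m)%N.
Proof.
apply: (finitely_many_classes (factorial_poly (factorial_poly (@factorial_field C)))
  (@shift_eval_inj _ _ _ (base_lin C (inord 1) ^+ n) io_inj) (shift_eval_frac (base_lin C (inord 1) ^+ n) io_frac) sigmaK sigmaA (disc_neq0 C k) sigmaT).
move=> d; rewrite poly_unitE => /andP[/size_poly1P[d1 d10 ->]].
rewrite coefC /= poly_unitE => /andP[/size_poly1P[d2 d20 ->] _].
by exists (sqrtC d2)%:P%:P; rewrite -!polyC_exp sqrtCK.
Qed.

End KleinField.

Lemma many_classes_transfer (F : fieldType) (s s' : F -> F) (g g' : {rmorphism F -> F}) M :
    cancel g g' -> cancel g' g -> (forall z, s' (g z) = g (s z)) ->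
  many_classes s M -> many_classes s' M.
Proof.
move=> gK g'K sg [e [he inj_e]]; exists (fun i => g (e i)); split=> [i|i j f ei].
  have [e0 se ev] := he i; split; first by rewrite fmorph_eq0.
    by rewrite sg se.
  move=> v [vM vD] vs; apply: (ev (v \o g)) => [|z] /=; last by rewrite -sg vs.
  split=> [x y x0 y0|x y x0 y0 xy0] /=.
    by rewrite rmorphM vM // inE fmorph_eq0.
  by rewrite rmorphD vD ?fmorph_eq0 // -rmorphD fmorph_eq0.
apply: (inj_e i j (g' f)); apply: (fmorph_inj g).
by rewrite ei !rmorphM /= -sg g'K.
Qed.

Lemma conj_subgroups_sym (G : groupType) (H L : groupClosed G) :
  conj_subgroups H L -> conj_subgroups L H.
Proof.
case=> g h; exists (g^-1)%g => x.
by split=> hx; [apply/h; rewrite conjgKV | rewrite -[x](conjgKV g); apply/h].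
Qed.

Section Family.
Variable C : numClosedFieldType.
Notation A := {poly {poly C}}.
Notation io := (@FracField.tofrac {poly A}).
Notation G := (space_coordinates C).

Let io_inj : injective io.
Proof. by move=> p q /eqP; rewrite tofrac_eq => /eqP. Qed.

Let G0 (a : C) : cst G a = io a%:P%:P%:P. Proof. by []. Qed.

Let G123 : [/\ coord G (inord 1) = io ('X%:P : A)%:P,
  coord G (inord 2) = io ('X : A)%:P & coord G (inord 3) = io 'X].
Proof.
have [_ c1 c2 c3] := affine_coordE C.
by split; [exact: (congr1 io c1) | exact: (congr1 io c2) | exact: (congr1 io c3)].
Qed.

Let G1 : coord G (inord 1) = io ('X%:P : A)%:P. Proof. by case: G123. Qed.
Let G2 : coord G (inord 2) = io ('X : A)%:P. Proof. by case: G123. Qed.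
Let G3 : coord G (inord 3) = io 'X. Proof. by case: G123. Qed.

Definition s4_subgroup k : groupClosed (Bir C 3) :=
  im_group (s4_rep k io_inj G1 G2 G3).

Definition sigma k := act G (klein_bir C (pred_exponent k) (inord 1)).
HB.instance Definition _ k := GRing.RMorphism.on (sigma k).

Lemma sigma_many k : many_classes (sigma k) #|{ffun 'I_k -> bool}|.
Proof. exact: (klein_many_classes k io_inj (@fraction_quotient _) G0 G1 G2 G3). Qed.

Lemma sigma_finite k : exists m, forall M, many_classes (sigma k) M -> (M <= m)%N.
Proof. exact: (klein_finitely_many k io_inj (@fraction_quotient _) G0 G1 G2 G3). Qed.

Lemma s4_subgroup_isog k : subgroup_isog {perm 'I_4} (s4_subgroup k).
Proof.
exists (s4_rep k io_inj G1 G2 G3); split; first exact: s4_rep_inj.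
by move=> x; apply: im_groupP.
Qed.

(** A conjugacy maps the double transposition of index 1 to an involution that is a
    square, hence to a double transposition, and a permutation q that fixes 0 moves
    the latter to index 1. *)
Lemma conj_many_classes k l M : conj_subgroups (s4_subgroup k) (s4_subgroup l) ->
  many_classes (sigma l) M -> many_classes (sigma k) M.
Proof.
case=> g hg; set fk := s4_rep k io_inj G1 G2 G3 in hg.
set fl := s4_rep l io_inj G1 G2 G3 in hg.
have fk_inj : injective fk by exact: s4_rep_inj.
have fl_inj : injective fl by exact: s4_rep_inj.
have [r0 er0] := klein_square.
have [r er] : exists r, fk r = (fl r0 ^ g)%g.
  have /hg/im_groupP[r er] : fl r0 \in s4_subgroup l by apply/im_groupP; exists r0.
  by exists r.
have err : fk (r * r)%g = (fl (kperm (inord 1)) ^ g)%g.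
  by rewrite gmulfM er -conjMg -gmulfM er0.
have f1 (gT : groupType) (f : {multiplicative gT -> Bir C 3}) : f 1%g = 1%g.
  by apply: (mulgI (f 1%g)); rewrite -gmulfM !mulg1.
have [j j0 ej] : exists2 j, j != ord0 & (r * r)%g = kperm j.
  apply: square_involution.
    by apply: fk_inj; rewrite gmulfM err -conjMg -gmulfM kperm_mul kmulii kperm0 !f1 conj1g.
  move=> r1; have := err; rewrite r1 f1 => /esym/eqP; rewrite conjg_eq1 => /eqP.
  rewrite -(f1 _ fl) => /fl_inj/permP/(_ ord0)/(congr1 val).
  by rewrite perm1 kpermE kmul0l /= inordK.
pose q : {perm 'I_4} := tperm j (inord 1).
have o1 : inord 1 != ord0 :> 'I_4 by rewrite -val_eqE /= inordK.
have q0 : q ord0 = ord0 by rewrite tpermD.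
have qj : q j = inord 1 by rewrite tpermL.
have ek : fk (kperm (inord 1)) = (fl (kperm (inord 1)) ^ (g * fk q))%g.
  rewrite conjgM -err ej /conjg.
  have fqV : (fk q)^-1%g = fk q^-1%g.
    by apply: (mulgI (fk q)); rewrite mulgV -gmulfM mulgV f1.
  by rewrite fqV -!gmulfM kperm_conj // qj mulKg.
move: ek; rewrite /fk /fl !s4_repE; set w := (g * _)%g => ek.
apply: (@many_classes_transfer _ _ _ (act G w) (act G w^-1%g)).
- exact: actK.
- by have := actK G w^-1%g; rewrite invgK.
by move=> z; rewrite /sigma ek /conjg 2!act_mul actK.
Qed.

(** The next index is chosen so that the lower bound for the number of classes
    exceeds the upper bounds for all the preceding indices. *)
Lemma s4_subgroups_not_conj : exists kappa : nat -> nat,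
  forall i j, i <> j -> ~ conj_subgroups (s4_subgroup (kappa i)) (s4_subgroup (kappa j)).
Proof.
have [m hm] := choice sigma_finite.
pose kappa := fix f i := if i is i'.+1 then (f i' + m (f i')).+1 else 0%N.
have lt_kappa i d : (m (kappa i) < kappa (i + d).+1)%N.
  elim: d => [|d IH]; first by rewrite addn0 /= ltnS leq_addl.
  by apply: (leq_trans IH); rewrite addnS /= -addSn (leq_trans (leqnSn _)) // ltnS leq_addr.
exists kappa => i j; wlog lt_ij : i j / (i < j)%N => [hw ij|_ cij].
  case: (ltngtP i j) => // [lt|lt]; first exact: hw.
  by move/conj_subgroups_sym; apply: hw => // ji; apply: ij.
have := hm _ _ (conj_many_classes cij (sigma_many (kappa j))).
apply/negP; rewrite -ltnNge card_ffun card_bool card_ord.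
have := lt_kappa i (j - i.+1)%N; rewrite -addSn subnKC // => lt_m.
exact: ltn_trans lt_m (ltn_expl _ _).
Qed.

End Family.

Theorem corollary1p8 (R : realType) :
  exists H : nat -> groupClosed (Bir R[i]%C 3),
    (forall k, subgroup_isog {perm 'I_4} (H k)) /\
    (forall k l, k <> l -> ~ conj_subgroups (H k) (H l)).
Proof.
have [kappa nc] := s4_subgroups_not_conj (R[i]%C).
exists (fun k => s4_subgroup _ (kappa k)); split; last exact: nc.
by move=> k; exact: s4_subgroup_isog.
Qed.
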